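(* Consider the AdaSketch-Newton algorithm (defined in the context) applied to $\min_{x\in\mathbb{R}^n} f(x)$ subject to $c(x)=0$, with constant input sequence $\theta_k=\theta\in(0,1]$ for all $k$. Let $z^\star=(x^\star,\lambda^\star)$ be a local solution, i.e. $x^\star$ is a local solution of the problem with Lagrange multiplier $\lambda^\star$ satisfying $\nabla f(x^\star)+G(x^\star)^T\lambda^\star=0$ and $c(x^\star)=0$. Assume: (i) the iterates $\{(x_k,\lambda_k)\}_{k\ge 0}$ are contained in a convex compact set $\mathcal{X}\times\Lambda$ such that over $\mathcal{X}$ the objective $f$ and the constraint $c$ are twice continuously differentiable with Lipschitz continuous Hessians; (ii) there exist absolute constants $\xi_G,\xi_B,\Upsilon_B>0$ such that for all $k$: $G_k$ has full row rank with $G_kG_k^T\succeq \xi_G I$, $u^TB_ku\ge \xi_B\|u\|^2$ for every $u$ with $G_ku=0$, and $\|B_k\|\le\Upsilon_B$; (iii) there exists a constant $\pi\in(0,1]$ such that the sketching matrices $S_{k,j}\sim S$ are iid and satisfy $P(S^Tu\ne 0)\ge\pi$ for every $u\in\mathbb{R}^{n+m}\setminus\{0\}$; (iv) $f$ and each coordinate of $c$ are thrice continuously differentiable over $\mathcal{X}$; (v) $\|H_k-B_k\|=O(\tau_k)$ for a sequence $\tau_k\to0$ as $k\to\infty$; (vi) $z_k\to z^\star$. Then for any $\varphi>0$ and all sufficiently large $k$, $\alpha_k=1$ and (noting that $\theta\delta_K<1$) $$\|z_{k+1}-z^\star\|\le(1+\varphi)\,\theta\,\delta_K\,\|z_k-z^\star\|,$$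 where $\delta_K$ is the stabilized value of the parameter $\delta_k$.
   Context: Problem and notation. $f:\mathbb{R}^n\to\mathbb{R}$ and $c:\mathbb{R}^n\to\mathbb{R}^m$ are twice continuously differentiable. $\|\cdot\|$ is the $\ell_2$ norm for vectors and the operator norm for matrices; $a\vee b=\max\{a,b\}$, $a\wedge b=\min\{a,b\}$; $(\cdot)^\dagger$ is the Moore–Penrose pseudoinverse. $\mathcal{L}(x,\lambda)=f(x)+\lambda^Tc(x)$ is the Lagrangian, $H(x,\lambda)=\nabla_x^2\mathcal{L}(x,\lambda)\in\mathbb{R}^{n\times n}$, and $G(x)=\nabla^Tc(x)\in\mathbb{R}^{m\times n}$ is the Jacobian of $c$. Write $z=(x,\lambda)$; a subscript $k$ denotes evaluation at $z_k=(x_k,\lambda_k)$, so $\nabla\mathcal{L}_k=(\nabla_x\mathcal{L}_k,\,c_k)$. For $\eta=(\eta_1,\eta_2)$ the exact augmented Lagrangian is $$\mathcal{L}_\eta(x,\lambda)=\mathcal{L}(x,\lambda)+\tfrac{\eta_1}{2}\|c(x)\|^2+\tfrac{\eta_2}{2}\|\nabla_x\mathcal{L}(x,\lambda)\|^2,$$ and $\nabla\mathcal{L}^k_{\eta_k}$ is its gradient in $(x,\lambda)$ at $z_k$ with $\eta=\eta_k=(\eta_{1,k},\eta_{2,k})$. Newton system. $B_k\in\mathbb{R}^{n\times n}$ is a symmetric modification of $H_k$, $\Gamma_k=\begin{pmatrix} B_k & G_k^T \\ G_k & 0 \end{pmatrix}$, and the exact direction $\Delta z_k$ solves $\Gamma_k\Delta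 z_k=-\nabla\mathcal{L}_k$. Sketching solver. $S\in\mathbb{R}^{(n+m)\times d}$ is a random matrix with distribution $\mathcal{P}$ ($d$ may be random). At outer iteration $k$, start from $\tilde\Delta z_{k,0}=0$; at inner iteration $j$ draw a fresh independent copy $S_{k,j}$ of $S$ and set $$\tilde\Delta z_{k,j+1}=\tilde\Delta z_{k,j}-\Gamma_kS_{k,j}(S_{k,j}^T\Gamma_k^2S_{k,j})^\dagger S_{k,j}^Tr_{k,j},\qquad r_{k,j}=\Gamma_k\tilde\Delta z_{k,j}+\nabla\mathcal{L}_k.$$ Auxiliary quantities. With $\sigma_{1,k}$ the least singular value of $G_k$, $$\Psi_k=\frac{20(\|B_k\|^2\vee1)}{(\xi_B\wedge1)(\sigma_{1,k}^2\wedge1)},\quad \Upsilon_k=\|G_k\|\vee\|H_k\|\vee1,\quad \delta_k^{\mathrm{trial}}=\frac{(0.5-\beta)\eta_{2,k}}{(1+\eta_{1,k}+\eta_{2,k})\Upsilon_k^2\Psi_k^2}.$$ Accuracy condition: $\|r_{k,j}\|\le\theta_k\delta_k\|\nabla\mathcal{L}_k\|/(\|\Gamma_k\|\Psi_k)$. Descent direction condition: $(\nabla\mathcal{L}^k_{\eta_k})^T\tilde\Delta z_{k,j}\le-\eta_{2,k}\|\nabla\mathcal{L}_k\|^2/2$. AdaSketch-Newton algorithm. Inputs: initial $z_0$; a sequence $\{\theta_k\}\subseteq(0,1]$; scalars $\eta_{1,0},\eta_{2,0},\xi_B>0$, $\delta_0\in(0,1)$, $\beta\in(0,0.5)$, $\nu>1$.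 For $k=0,1,2,\dots$: (1) compute $f_k,\nabla f_k,c_k,G_k,H_k$, generate $B_k$, compute $\Psi_k,\Upsilon_k,\delta_k^{\mathrm{trial}}$, and set $\delta_k\leftarrow\delta_k\wedge\delta_k^{\mathrm{trial}}$; set the inexact direction to $0$. (2) Until both the accuracy condition and the descent direction condition hold: run the sketching update (continuing from the latest inexact direction) until the accuracy condition holds; then, if the descent direction condition fails, update $\eta_{1,k}\leftarrow\eta_{1,k}\nu^2$, $\eta_{2,k}\leftarrow\eta_{2,k}/\nu$, recompute $\delta_k^{\mathrm{trial}}$, and set $\delta_k\leftarrow(\delta_k/\nu^4)\wedge\delta_k^{\mathrm{trial}}$. (3) Let $\tilde\Delta z_k$ be the resulting direction. Choose $\alpha_k$ by backtracking line search, i.e. $\alpha_k$ is the largest element of $\{1,\rho,\rho^2,\dots\}$ (for a fixed $\rho\in(0,1)$) satisfying the Armijo condition $\mathcal{L}_{\eta_k}(z_k+\alpha_k\tilde\Delta z_k)\le\mathcal{L}_{\eta_k}(z_k)+\alpha_k\beta(\nabla\mathcal{L}^k_{\eta_k})^T\tilde\Delta z_k$. Set $z_{k+1}=z_k+\alpha_k\tilde\Delta z_k$. (4) Set $\eta_{1,k+1}\leftarrow\eta_{1,k}$, $\eta_{2,k+1}\leftarrow\eta_{2,k}$, $\delta_{k+1}\leftarrow\delta_k$. The constant $\xi_B$ in the assumption on $B_k$ is the input parameter $\xi_B$. Stabilized parameters. $K$ denotes an iteration threshold (which, according to the paper, exists with probability one under assumptions (i)–(iii)) such that $(\eta_{1,k},\eta_{2,k},\delta_k)=(\eta_{1,K},\eta_{2,K},\delta_K)$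 for all $k\ge K$, the values being those at the end of outer iteration $k$. *)

(* Defs.v *)
From HB Require Import structures.
From mathcomp Require Export all_boot all_order all_algebra.
From mathcomp Require Export all_classical all_reals all_analysis.

Set Implicit Arguments.
Unset Strict Implicit.
Unset Printing Implicit Defensive.

Import Order.TTheory GRing.Theory Num.Theory.
Import numFieldNormedType.Exports.

Local Open Scope classical_set_scope.
Local Open Scope ring_scope.

(* The library norm on matrices is the entrywise sup norm. It induces the usual
   topology, but every quantitative bound uses the l2 and operator norms below. *)

Section Euclidean.
Context {R : realType}.

Definition dot p (u v : 'cV[R]_p) : R := (u^T *m v) 0 0.

Definition norm2 p (u : 'cV[R]_p) : R := Num.sqrt (dot u u).

Definition opnorm p q (A : 'M[R]_(p, q)) : R :=
  sup [set norm2 (A *m u) | u in [set u : 'cV[R]_q | norm2 u <= 1]].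

Definition loewner_le p (A B : 'M[R]_p) : Prop :=
  forall u : 'cV[R]_p, 0 <= dot u ((B - A) *m u).

(* For p <= q these are the p singular values of a p x q matrix. *)
Definition singular_value p q (A : 'M[R]_(p, q)) (s : R) : Prop :=
  0 <= s /\ eigenvalue (A *m A^T) (s ^+ 2).

Definition least_singular_value p q (A : 'M[R]_(p, q)) : R :=
  inf [set s | singular_value A s].

Definition penrose p q (A : 'M[R]_(p, q)) (X : 'M[R]_(q, p)) : Prop :=
  [/\ A *m X *m A = A, X *m A *m X = X,
      (A *m X)^T = A *m X & (X *m A)^T = X *m A].

Definition mp_pinv p q (A : 'M[R]_(p, q)) : 'M[R]_(q, p) :=
  xget 0 [set X | penrose A X].

End Euclidean.

Section Calculus.
Context {R : realType}.

Definition partial n (i : 'I_n) (g : 'cV[R]_n -> R) (x : 'cV[R]_n) : R :=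
  'D_(delta_mx i 0) g x.

Definition grad n (g : 'cV[R]_n -> R) (x : 'cV[R]_n) : 'cV[R]_n :=
  \col_i partial i g x.

Definition hess n (g : 'cV[R]_n -> R) (x : 'cV[R]_n) : 'M[R]_n :=
  \matrix_(i, j) partial i (partial j g) x.

Definition jac n m (c : 'cV[R]_n -> 'cV[R]_m) (x : 'cV[R]_n) : 'M[R]_(m, n) :=
  \matrix_(i, j) partial j (fun y => c y i 0) x.

(* g is k times differentiable at every point of A and its partial derivatives
   of order k are continuous on A. Derivatives are those of g as a function on
   the whole space, so A need not be open; for A open (in particular A = setT)
   this is the usual C^k. *)
Fixpoint Ck_on n (k : nat) (A : set 'cV[R]_n) (g : 'cV[R]_n -> R) : Prop :=
  if k is k'.+1 then
    (forall x, A x -> differentiable g x) /\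
    (forall i : 'I_n, Ck_on k' A (partial i g))
  else {within A, continuous g}.

Definition lipschitz_hess_on n (A : set 'cV[R]_n) (g : 'cV[R]_n -> R) : Prop :=
  exists Lip : R, forall x y, A x -> A y ->
    opnorm (hess g x - hess g y) <= Lip * norm2 (x - y).

End Calculus.

(* A sketching matrix carries its (possibly random) number of columns d. *)
Definition sketch (R : realType) (N : nat) := {d : nat & 'M[R]_(N, d)}.

HB.instance Definition _ (R : realType) N := Choice.on (sketch R N).
HB.instance Definition _ (R : realType) N :=
  isPointed.Build (sketch R N) (existT (fun d => 'M[R]_(N, d)) 0%N 0).

(* Borel sigma-algebra of the disjoint union of the spaces of N x d matrices. *)
Definition sketch_space (R : realType) (N : nat) :=
  g_sigma_algebraType (@open {d : nat & 'M[R]_(N, d)} : set (set (sketch R N))).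

Definition mutually_independent d d' (Omega : measurableType d)
    (R : realType) (P : probability Omega R) (T : measurableType d')
    (I : choiceType) (X : I -> {RV P >-> T}) : Prop :=
  forall (s : seq I) (A : I -> set T), uniq s -> (forall i, measurable (A i)) ->
    P (\bigcap_(i in [set` s]) (X i @^-1` A i)) =
    (\prod_(i <- s) fine (P (X i @^-1` A i)))%:E.

Section Problem.
Context {R : realType} {n m : nat}.
Variables (f : 'cV[R]_n -> R) (c : 'cV[R]_n -> 'cV[R]_m).
Implicit Types (x : 'cV[R]_n) (lam : 'cV[R]_m) (z : 'cV[R]_(n + m)).

Definition lagrangian x lam : R := f x + dot lam (c x).

Definition grad_xL x lam : 'cV[R]_n := grad (lagrangian^~ lam) x.

Definition hess_xL x lam : 'M[R]_n := hess (lagrangian^~ lam) x.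

(* z = (x, lam) is the stacked vector col_mx x lam. *)
Definition gradL z : 'cV[R]_(n + m) :=
  col_mx (grad_xL (usubmx z) (dsubmx z)) (c (usubmx z)).

Definition auglag (eta1 eta2 : R) z : R :=
  let x := usubmx z in let lam := dsubmx z in
  lagrangian x lam + eta1 / 2 * norm2 (c x) ^+ 2
  + eta2 / 2 * norm2 (grad_xL x lam) ^+ 2.

Definition local_solution x : Prop :=
  c x = 0 /\ \forall y \near x, c y = 0 -> f x <= f y.

Definition lagrange_multiplier x lam : Prop :=
  grad f x + (jac c x)^T *m lam = 0.

End Problem.

Record tuning (R : realType) := Tuning { eta1 : R; eta2 : R; delta : R }.

Record adasketch_input (R : realType) (n m : nat) := AdaSketchInput {
  z_init : 'cV[R]_(n + m);
  tuning_init : tuning R;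
  theta_seq : nat -> R;
  xiB : R;
  beta : R;
  nu : R;
  rho : R
}.

Definition valid_input (R : realType) n m (inp : adasketch_input R n m) : Prop :=
  [/\ [/\ 0 < eta1 (tuning_init inp), 0 < eta2 (tuning_init inp),
          0 < delta (tuning_init inp) & delta (tuning_init inp) < 1],
      forall k, 0 < theta_seq inp k /\ theta_seq inp k <= 1,
      0 < xiB inp, 0 < beta inp /\ beta inp < 2^-1 &
      1 < nu inp /\ (0 < rho inp /\ rho inp < 1)].

(* State of the direction search within one outer iteration: current inexact
   direction, number of sketches drawn so far, current parameters. *)
Record search_state (R : realType) (N : nat) := SearchState {
  dir : 'cV[R]_N;
  drawn : nat;
  tun : tuning R
}.

Section AdaSketchNewton.
Context {R : realType} {n m : nat}.
Variables (f : 'cV[R]_n -> R) (c : 'cV[R]_n -> 'cV[R]_m).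
Variable inp : adasketch_input R n m.
Implicit Types (z : 'cV[R]_(n + m)) (B : 'M[R]_n) (t : tuning R).

Definition Gam z B : 'M[R]_(n + m) :=
  let G := jac c (usubmx z) in block_mx B G^T G 0.

Definition Psi z B : R :=
  20 * Num.max (opnorm B ^+ 2) 1 /
  (Num.min (xiB inp) 1 *
   Num.min (least_singular_value (jac c (usubmx z)) ^+ 2) 1).

Definition Ups z : R :=
  Num.max (Num.max (opnorm (jac c (usubmx z)))
                   (opnorm (hess_xL f c (usubmx z) (dsubmx z)))) 1.

Definition delta_trial z B (e1 e2 : R) : R :=
  (2^-1 - beta inp) * e2 / ((1 + e1 + e2) * Ups z ^+ 2 * Psi z B ^+ 2).

Definition residual z B (d : 'cV[R]_(n + m)) : 'cV[R]_(n + m) :=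
  Gam z B *m d + gradL f c z.

Definition accurate (theta : R) z B t (d : 'cV[R]_(n + m)) : bool :=
  norm2 (residual z B d) <=
  theta * delta t * norm2 (gradL f c z) / (opnorm (Gam z B) * Psi z B).

Definition descent z t (d : 'cV[R]_(n + m)) : bool :=
  dot (grad (auglag f c (eta1 t) (eta2 t)) z) d <=
  - eta2 t * norm2 (gradL f c z) ^+ 2 / 2.

Definition sketch_update z B (s : sketch R (n + m)) (d : 'cV[R]_(n + m)) :
    'cV[R]_(n + m) :=
  let S := projT2 s in
  let A := Gam z B in
  d - A *m S *m mp_pinv (S^T *m (A *m A) *m S) *m S^T *m residual z B d.

Definition tuning_start z B t : tuning R :=
  Tuning (eta1 t) (eta2 t)
         (Num.min (delta t) (delta_trial z B (eta1 t) (eta2 t))).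

Definition tuning_update z B t : tuning R :=
  let e1 := eta1 t * nu inp ^+ 2 in
  let e2 := eta2 t / nu inp in
  Tuning e1 e2 (Num.min (delta t / nu inp ^+ 4) (delta_trial z B e1 e2)).

(* One step of the nested loops of the direction search: sketch as long as the
   accuracy condition fails; once it holds, either update the parameters or,
   if the descent condition holds too, stay put. *)
Definition search_step theta z B (S : nat -> sketch R (n + m))
    (st : search_state R (n + m)) : search_state R (n + m) :=
  let: SearchState d j t := st in
  if ~~ accurate theta z B t d then
    SearchState (sketch_update z B (S j) d) j.+1 t
  else if ~~ descent z t d then
    SearchState d j (tuning_update z B t)
  else st.

(* The direction search started at z with parameters t0 terminates, with
   direction d and parameters t. *)
Definition search_returns theta z B (S : nat -> sketch R (n + m)) t0
    (d : 'cV[R]_(n + m)) t : Prop :=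
  exists N : nat,
    let st := iter N (search_step theta z B S)
                   (SearchState 0 0 (tuning_start z B t0)) in
    [/\ dir st = d, tun st = t, accurate theta z B t d & descent z t d].

Definition armijo z t (d : 'cV[R]_(n + m)) (a : R) : bool :=
  let L := auglag f c (eta1 t) (eta2 t) in
  L (z + a *: d) <= L z + a * beta inp * dot (grad L z) d.

Definition line_search_returns z t (d : 'cV[R]_(n + m)) (a : R) : Prop :=
  exists i : nat, [/\ a = rho inp ^+ i, armijo z t d (rho inp ^+ i) &
    forall j : nat, (j < i)%N -> ~~ armijo z t d (rho inp ^+ j)].

(* The algorithm, with matrices B k and sketches S k j, generates iterates z k,
   inexact directions dz k, stepsizes alpha k, and parameters par k at the end
   of outer iteration k. *)
Definition adasketch_run (B : nat -> 'M[R]_n)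
    (S : nat -> nat -> sketch R (n + m)) (z : nat -> 'cV[R]_(n + m))
    (par : nat -> tuning R) (dz : nat -> 'cV[R]_(n + m)) (alpha : nat -> R) :
    Prop :=
  z 0%N = z_init inp /\
  forall k : nat,
    let t0 := if k is k'.+1 then par k' else tuning_init inp in
    [/\ (B k)^T = B k,
        search_returns (theta_seq inp k) (z k) (B k) (S k) t0 (dz k) (par k),
        line_search_returns (z k) (par k) (dz k) (alpha k) &
        z k.+1 = z k + alpha k *: dz k].

End AdaSketchNewton.

(* Main.v *)
Require Import Defs.
From mathcomp Require Import ring lra.

(** The convergence holds along almost every sample path, so the proof fixes
    one and argues deterministically. Write zs = (xs, lams), h = z k - zs, d =
    dz k, g = gradL (z k), let J be the derivative of gradL at zs, and let Gm
    = Gam (z k) (B k). Three facts hold along the path: gradL zs = 0, hence g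
    = J h + o(|h|); Gm tends to J, because B k is symmetric and tends to the
    Hessian of the Lagrangian; and |u| <= Psi |Gm u| for every u, with Psi
    bounded along the iterates.

    Rate. Gm (h + d) is the residual Gm d + g up to o(|h|). The accuracy test
    bounds the residual by theta delta |g| / (|Gm| Psi), and |g| <= |Gm| |h| +
    o(|h|). Applying |u| <= Psi |Gm u| to u = h + d makes the factors |Gm| and
    Psi cancel and leaves |h + d| <= (theta delta + o(1)) |h|
    ([inexact_newton_contraction]). The bound by Psi is the classical estimate
    for saddle-point matrices ([saddle_lower_bound]). It requires |G^T v| >=
    sigma |v| for the least singular value sigma of G, that is, the
    variational characterization of the least eigenvalue of G G^T
    ([least_eigenvalue]).

    Unit step. The augmented Lagrangian is the Lagrangian plus a weighted sum
    of squares of the entries of gradL. As gradL vanishes at zs, its gradient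
    is A (y - zs) + o(|y - zs|) with A = J + J^T E J and E the diagonal matrix
    of weights: third derivatives of f and c would enter the Hessian only
    multiplied by gradL. The mean value theorem turns this into a quadratic
    model of the increment ([penalized_increment]). The model minus beta
    (gradient . d) equals (1/2 - beta) (gradient . d) + 1/2 d . A (h + d) +
    o(|h|^2). The first term is at most -(1/2 - beta) eta2 |g|^2 / 2 by the
    descent test. In the second one, J (h + d) is the residual up to o(|h|),
    and the definition of delta_trial bounds this term by a fraction of the
    first ([unit_step_sufficient_decrease]). Hence the first trial step of the
    line search is accepted.

    Finally theta delta < 1 since the updates never increase delta
    ([search_returns_invariant]). *)

Set Implicit Arguments.
Unset Strict Implicit.
Unset Printing Implicit Defensive.

Import Order.TTheory GRing.Theory Num.Theory.
Import numFieldNormedType.Exports.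

Local Open Scope classical_set_scope.
Local Open Scope ring_scope.

(** * Euclidean geometry and the operator norm *)

Section EuclideanSpace.
Context {R : realType}.

Section Vectors.
Context {p : nat}.
Implicit Types (u v w : 'cV[R]_p) (a : R).

Lemma dotE u v : dot u v = \sum_i u i 0 * v i 0.
Proof. by rewrite /dot mxE; apply: eq_bigr => i _; rewrite mxE. Qed.

Lemma dotC u v : dot u v = dot v u.
Proof. by rewrite !dotE; apply: eq_bigr => i _; rewrite mulrC. Qed.

Lemma dotDl u v w : dot (u + v) w = dot u w + dot v w.
Proof. by rewrite /dot raddfD mulmxDl mxE. Qed.

Lemma dotDr u v w : dot u (v + w) = dot u v + dot u w.
Proof. by rewrite dotC dotDl ![dot _ u]dotC. Qed.

Lemma dotZl a u v : dot (a *: u) v = a * dot u v.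
Proof. by rewrite /dot linearZ /= -scalemxAl mxE. Qed.

Lemma dotZr a u v : dot u (a *: v) = a * dot u v.
Proof. by rewrite dotC dotZl dotC. Qed.

Lemma dotNl u v : dot (- u) v = - dot u v.
Proof. by rewrite -scaleN1r dotZl mulN1r. Qed.

Lemma dotNr u v : dot u (- v) = - dot u v.
Proof. by rewrite dotC dotNl dotC. Qed.

Lemma dotBl u v w : dot (u - v) w = dot u w - dot v w.
Proof. by rewrite dotDl dotNl. Qed.

Lemma dotBr u v w : dot u (v - w) = dot u v - dot u w.
Proof. by rewrite dotDr dotNr. Qed.

Lemma dot0l u : dot 0 u = 0.
Proof. by rewrite -(scale0r 0) dotZl mul0r. Qed.

Lemma dot_ge0 u : 0 <= dot u u.
Proof. by rewrite dotE sumr_ge0 // => i _; rewrite -expr2 sqr_ge0. Qed.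

Lemma dot_eq0 u : dot u u = 0 -> u = 0.
Proof.
rewrite dotE => /eqP; rewrite psumr_eq0 => [/allP h|i _]; last first.
  by rewrite -expr2 sqr_ge0.
apply/colP => i; rewrite mxE; apply/eqP.
by have := h i (mem_index_enum _); rewrite mulf_eq0 orbb.
Qed.

Lemma norm2_ge0 u : 0 <= norm2 u.
Proof. exact: sqrtr_ge0. Qed.

Lemma norm2_sqr u : norm2 u ^+ 2 = dot u u.
Proof. by rewrite sqr_sqrtr // dot_ge0. Qed.

Lemma norm2_eq0 u : norm2 u = 0 -> u = 0.
Proof. by move=> u0; apply: dot_eq0; rewrite -norm2_sqr u0 expr0n. Qed.

Lemma norm2_gt0 u : u != 0 -> 0 < norm2 u.
Proof. by rewrite lt0r norm2_ge0 andbT; apply: contra_neq => /norm2_eq0. Qed.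

Lemma norm2Z a u : norm2 (a *: u) = `|a| * norm2 u.
Proof.
by rewrite /norm2 dotZl dotZr mulrA sqrtrM -?expr2 ?sqr_ge0 // sqrtr_sqr.
Qed.

Lemma norm20 : norm2 (0 : 'cV[R]_p) = 0.
Proof. by rewrite -(scale0r 0) norm2Z normr0 mul0r. Qed.

Lemma norm2N u : norm2 (- u) = norm2 u.
Proof. by rewrite -scaleN1r norm2Z normrN1 mul1r. Qed.

End Vectors.

Lemma dot_mulmx p q (A : 'M[R]_(p, q)) (u : 'cV[R]_q) (v : 'cV[R]_p) :
  dot (A *m u) v = dot u (A^T *m v).
Proof. by rewrite /dot trmx_mul mulmxA. Qed.

Lemma discriminant_le (a b c : R) : 0 <= c ->
  (forall t, 0 <= a + 2 * b * t + c * t ^+ 2) -> b ^+ 2 <= a * c.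
Proof.
rewrite le_eqVlt => /predU1P[<-|c0] h.
  rewrite mulr0; have [->|b0] := eqVneq b 0; first by rewrite expr0n.
  have := h (- (1 + a) / (2 * b)); rewrite mul0r addr0.
  have -> : a + 2 * b * (- (1 + a) / (2 * b)) = -1 by field.
  by rewrite ler0N1.
have cN0 : c != 0 by rewrite gt_eqF.
have := h (- b / c).
have -> : a + 2 * b * (- b / c) + c * (- b / c) ^+ 2 = (a * c - b ^+ 2) / c.
  by field.
by rewrite pmulr_lge0 ?invr_gt0 // subr_ge0.
Qed.

(** A nonnegative quadratic form satisfies the Cauchy-Schwarz inequality because
    it is nonnegative along every line, so its discriminant there is too. *)
Lemma psd_Cauchy_Schwarz p (N : 'M[R]_p) (u v : 'cV[R]_p) :
  N^T = N -> (forall w, 0 <= dot w (N *m w)) ->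
  dot u (N *m v) ^+ 2 <= dot u (N *m u) * dot v (N *m v).
Proof.
move=> symN psdN; apply: discriminant_le => // t.
have := psdN (u + t *: v).
rewrite mulmxDr -scalemxAr !(dotDl, dotDr, dotZl, dotZr).
have -> : dot v (N *m u) = dot u (N *m v) by rewrite dotC dot_mulmx symN.
by congr (_ <= _); ring.
Qed.

Section NormInequalities.
Context {p : nat}.
Implicit Types u v : 'cV[R]_p.

Lemma dot_le u v : `|dot u v| <= norm2 u * norm2 v.
Proof.
rewrite -(ler_pXn2r (isT : (0 < 2)%N)) ?nnegrE ?mulr_ge0 ?norm2_ge0 //.
rewrite real_normK ?num_real // exprMn !norm2_sqr.
have := @psd_Cauchy_Schwarz p 1%:M u v (trmx1 _ _).
by rewrite !mul1mx; apply=> w; rewrite mul1mx dot_ge0.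
Qed.

Lemma norm2D u v : norm2 (u + v) <= norm2 u + norm2 v.
Proof.
rewrite -(ler_pXn2r (isT : (0 < 2)%N)) ?nnegrE ?addr_ge0 ?norm2_ge0 //.
rewrite sqrrD !norm2_sqr dotDl !dotDr (dotC v u).
by have := ler_norm (dot u v); have := dot_le u v; lra.
Qed.

Lemma norm2B u v : norm2 (u - v) <= norm2 u + norm2 v.
Proof. by rewrite -(norm2N v) norm2D. Qed.

Lemma norm2_coord u i : `|u i 0| <= norm2 u.
Proof.
rewrite -sqrtr_sqr ler_sqrt ?dot_ge0 // dotE (bigD1 i) //= -expr2 lerDl.
by rewrite sumr_ge0 // => j _; rewrite -expr2 sqr_ge0.
Qed.

Lemma norm2_le_sum u : norm2 u <= \sum_i `|u i 0|.
Proof.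
have sum_ge0 (s : seq 'I_p) : 0 <= \sum_(i <- s) `|u i 0| by apply: sumr_ge0.
rewrite -(ler_pXn2r (isT : (0 < 2)%N)) ?nnegrE ?norm2_ge0 ?sum_ge0 //.
rewrite norm2_sqr dotE.
elim: (index_enum _) => [|i s ih]; first by rewrite !big_nil expr0n.
rewrite !big_cons; have := sum_ge0 s; have := normr_ge0 (u i 0).
have : `|u i 0| ^+ 2 = u i 0 * u i 0 by rewrite real_normK ?num_real // expr2.
nra.
Qed.

End NormInequalities.

Lemma norm2_col_mx p q (u : 'cV[R]_p) (v : 'cV[R]_q) :
  norm2 (col_mx u v) ^+ 2 = norm2 u ^+ 2 + norm2 v ^+ 2.
Proof. by rewrite !norm2_sqr /dot tr_col_mx mul_row_col mxE. Qed.

Lemma dot_col_mx p q (u u' : 'cV[R]_p) (v v' : 'cV[R]_q) :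
  dot (col_mx u v) (col_mx u' v') = dot u u' + dot v v'.
Proof. by rewrite /dot tr_col_mx mul_row_col mxE. Qed.

Lemma norm2_diag_mx p (e : 'rV[R]_p) (s : R) u : 0 <= s ->
  (forall i, `|e 0 i| <= s) -> norm2 (diag_mx e *m u) <= s * norm2 u.
Proof.
move=> s0 es.
rewrite -(ler_pXn2r (isT : (0 < 2)%N)) ?nnegrE ?mulr_ge0 ?norm2_ge0 //.
rewrite exprMn !norm2_sqr !dotE mulr_sumr ler_sum // => i _.
rewrite mul_diag_mx !mxE mulrACA -!expr2 ler_wpM2r ?sqr_ge0 //.
by rewrite -real_normK ?num_real // lerXn2r ?nnegrE.
Qed.

Section OperatorNorm.
Context {p q : nat}.
Implicit Types A : 'M[R]_(p, q).

Lemma norm2_mulmx_sum A u :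
  norm2 (A *m u) <= (\sum_i \sum_j `|A i j|) * norm2 u.
Proof.
apply: le_trans (norm2_le_sum _) _; rewrite mulr_suml ler_sum // => i _.
rewrite mxE mulr_suml; apply: le_trans (ler_norm_sum _ _ _) _.
by apply: ler_sum => j _; rewrite normrM ler_wpM2l // norm2_coord.
Qed.

Lemma opnorm_has_sup A :
  has_sup [set norm2 (A *m u) | u in [set u : 'cV[R]_q | norm2 u <= 1]].
Proof.
split; first by exists (norm2 (A *m 0)), 0; rewrite //= norm20.
exists (\sum_i \sum_j `|A i j|) => _ [u /= u1 <-].
apply: le_trans (norm2_mulmx_sum _ _) _; rewrite ler_piMr //.
by apply: sumr_ge0 => i _; apply: sumr_ge0.
Qed.

Lemma opnorm_ge0 A : 0 <= opnorm A.
Proof.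
apply: le_trans (norm2_ge0 (A *m 0)) _.
by apply: (ub_le_sup (opnorm_has_sup A).2); exists 0; rewrite //= norm20.
Qed.

Lemma norm2_mulmx A u : norm2 (A *m u) <= opnorm A * norm2 u.
Proof.
have [->|u0] := eqVneq u 0; first by rewrite mulmx0 !norm20 mulr0.
have nu0 := norm2_gt0 u0.
rewrite -ler_pdivrMr //; apply: (ub_le_sup (opnorm_has_sup A).2).
exists ((norm2 u)^-1 *: u) => /=.
  by rewrite norm2Z ger0_norm ?invr_ge0 ?norm2_ge0 // mulVf ?gt_eqF.
by rewrite -scalemxAr norm2Z ger0_norm ?invr_ge0 ?norm2_ge0 // mulrC.
Qed.

Lemma coord_opnorm A i j : `|A i j| <= opnorm A.
Proof.
have := norm2_mulmx A (delta_mx j 0).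
have -> : norm2 (delta_mx j 0 : 'cV[R]_q) = 1.
  rewrite /norm2 dotE (bigD1 j) //= big1 => [|k /negbTE jk].
    by rewrite !mxE !eqxx mulr1 addr0 sqrtr1.
  by rewrite !mxE jk mul0r.
rewrite mulr1; apply: le_trans.
have -> : A i j = (A *m delta_mx j 0 : 'cV[R]_p) i 0.
  by rewrite -colE mxE.
exact: norm2_coord.
Qed.

End OperatorNorm.

Lemma norm2_mulmx_small p q (A : 'M[R]_(p, q)) (k : R) u :
  0 <= k -> (forall i j, `|A i j| <= k / (p * q).+1%:R) ->
  norm2 (A *m u) <= k * norm2 u.
Proof.
move=> k0 hA; apply: le_trans (norm2_mulmx_sum _ _) _.
rewrite ler_wpM2r ?norm2_ge0 //.
apply: (@le_trans _ _ (\sum_(i < p) \sum_(j < q) k / (p * q).+1%:R)).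
  by apply: ler_sum => i _; apply: ler_sum.
rewrite !sumr_const !card_ord -mulrnA -[leLHS]mulr_natl mulrCA.
by rewrite ler_piMr // ler_pdivrMr // mul1r ler_nat mulnC.
Qed.
End EuclideanSpace.

(** * Least singular value and saddle-point matrices *)

Section SpectralBounds.
Context {R : realType}.

Lemma eigenvalue_sym p (A : 'M[R]_p) (a : R) : A^T = A -> eigenvalue A a ->
  exists2 u : 'cV[R]_p, u != 0 & A *m u = a *: u.
Proof.
move=> symA /eigenvalueP[u uA u0]; exists u^T; last first.
  by rewrite -{1}symA -trmx_mul uA linearZ.
by apply: contra_neq u0 => /(congr1 trmx); rewrite trmxK trmx0.
Qed.

Lemma eigenvalue_non_unit p (A : 'M[R]_p) (a : R) :
  A - a%:M \notin unitmx -> eigenvalue A a.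
Proof.
by apply: contraR; rewrite /eigenvalue /eigenspace negbK kermx_eq0
  -row_free_unit.
Qed.

(** An invertible nonnegative form is coercive: with w := N^-1 u, the
    Cauchy-Schwarz inequality of the form bounds
    (u . u)^2 = (u . N w)^2 by (u . N u) (w . u). *)
Lemma psd_unit_coercive p (N : 'M[R]_p) :
  N^T = N -> (forall w, 0 <= dot w (N *m w)) -> N \in unitmx ->
  exists2 k, 0 < k & forall u, k * dot u u <= dot u (N *m u).
Proof.
move=> symN psdN uN; set b := opnorm (invmx N) + 1.
have b0 : 0 < b by rewrite ltr_wpDl // opnorm_ge0.
exists b^-1 => [|u]; first by rewrite invr_gt0.
rewrite ler_pdivrMl //.
have [->|u0] := eqVneq u 0; first by rewrite !dot0l mulr0.
have uu0 : 0 < dot u u by rewrite -norm2_sqr exprn_gt0 // norm2_gt0.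
set w := invmx N *m u.
have Nw : N *m w = u by rewrite mulmxA mulmxV // mul1mx.
have := psd_Cauchy_Schwarz u w symN psdN.
rewrite Nw => CS.
have wu : dot w u <= b * dot u u.
  apply: le_trans (ler_norm _) _; apply: le_trans (dot_le _ _) _.
  rewrite -norm2_sqr expr2 mulrA ler_wpM2r ?norm2_ge0 //.
  apply: le_trans (norm2_mulmx _ _) _.
  by rewrite ler_wpM2r ?norm2_ge0 // lerDl.
rewrite -(ler_pM2r uu0) -expr2; apply: le_trans CS _.
by rewrite -mulrA mulrCA ler_wpM2l.
Qed.

(** The infimum a of the Rayleigh quotient is an eigenvalue: otherwise A - a I
    would be an invertible nonnegative form, hence coercive, and the quotient
    would stay above some number larger than a. *)
Lemma least_eigenvalue p (A : 'M[R]_p) : (0 < p)%N -> A^T = A ->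
  exists2 a, eigenvalue A a & forall u, a * dot u u <= dot u (A *m u).
Proof.
move=> p0 symA.
pose Q := [set dot u (A *m u) | u in [set u : 'cV[R]_p | dot u u = 1]].
have Q0 : Q !=set0.
  exists (dot (delta_mx (Ordinal p0) 0) (A *m delta_mx (Ordinal p0) 0)).
  exists (delta_mx (Ordinal p0) 0) => //=.
  rewrite dotE (bigD1 (Ordinal p0)) //= big1 => [|k /negbTE jk].
    by rewrite !mxE !eqxx mulr1 addr0.
  by rewrite !mxE jk mul0r.
have Qlb : has_lbound Q.
  exists (- opnorm A) => _ [u /= u1 <-].
  have := dot_le u (A *m u); have := norm2_mulmx A u.
  have -> : norm2 u = 1 by rewrite /norm2 u1 sqrtr1.
  rewrite mulr1 mul1r; have := ler_norm (- dot u (A *m u)).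
  by rewrite normrN; lra.
have lb u : inf Q * dot u u <= dot u (A *m u).
  have [->|u0] := eqVneq u 0; first by rewrite !dot0l mulr0.
  have [r [v v1 ->]] : exists r, exists2 v, dot v v = 1 & u = r *: v.
    have nu0 := norm2_gt0 u0; exists (norm2 u), ((norm2 u)^-1 *: u).
      by rewrite dotZl dotZr -norm2_sqr expr2 mulKf ?gt_eqF // mulVf ?gt_eqF.
    by rewrite scalerA mulfV ?gt_eqF // scale1r.
  rewrite -scalemxAr !dotZl !dotZr v1 mulr1 mulrC !mulrA.
  rewrite ler_wpM2l -?expr2 ?sqr_ge0 //.
  by apply: ge_inf => //; exists v.
exists (inf Q) => //; apply: eigenvalue_non_unit; apply/negP => uN.
have symN : (A - (inf Q)%:M)^T = A - (inf Q)%:M.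
  by rewrite linearB /= tr_scalar_mx symA.
have NE u : dot u ((A - (inf Q)%:M) *m u) = dot u (A *m u) - inf Q * dot u u.
  by rewrite mulmxBl mul_scalar_mx dotBr dotZr.
have [|k k0 hk] := psd_unit_coercive symN _ uN.
  by move=> w; rewrite NE subr_ge0.
suff : inf Q + k <= inf Q by rewrite gerDl leNgt k0.
apply: lb_le_inf => // _ [u /= u1 <-].
by have := hk u; rewrite NE u1; lra.
Qed.

Section LeastSingularValue.
Context {p q : nat} (A : 'M[R]_(p, q)).
Hypothesis p_gt0 : (0 < p)%N.

Let gram_sym : (A *m A^T)^T = A *m A^T.
Proof. by rewrite trmx_mul trmxK. Qed.

Let gram_dot u : dot u (A *m A^T *m u) = norm2 (A^T *m u) ^+ 2.
Proof. by rewrite norm2_sqr -mulmxA dotC dot_mulmx. Qed.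

(** The least eigenvalue of A A^T is a nonnegative number, hence the square of a
    singular value. *)
Lemma least_singular_value_exists : exists2 t, singular_value A t &
  forall u, t * norm2 u <= norm2 (A^T *m u).
Proof.
have [a] := least_eigenvalue p_gt0 gram_sym => /[dup] ea.
move=> /(eigenvalue_sym gram_sym)[v v0 Av] ha.
have a0 : 0 <= a.
  have := gram_dot v; rewrite Av dotZr => h.
  have := sqr_ge0 (norm2 (A^T *m v)); rewrite -h pmulr_lge0 //.
  by rewrite -norm2_sqr exprn_gt0 // norm2_gt0.
exists (Num.sqrt a) => [|u]; first by split; rewrite ?sqrtr_ge0 // sqr_sqrtr.
rewrite -(ler_pXn2r (isT : (0 < 2)%N)) ?nnegrE ?mulr_ge0 ?sqrtr_ge0 //;
  rewrite ?norm2_ge0 //.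
by rewrite exprMn sqr_sqrtr // norm2_sqr -gram_dot.
Qed.

Lemma least_singular_value_has_inf : has_inf [set s | singular_value A s].
Proof.
split; last by exists 0 => s [].
by have [t tA _] := least_singular_value_exists; exists t.
Qed.

Lemma least_singular_value_le u :
  least_singular_value A * norm2 u <= norm2 (A^T *m u).
Proof.
have [t tA ht] := least_singular_value_exists; apply: le_trans (ht u).
rewrite ler_wpM2r ?norm2_ge0 //.
by apply: ge_inf => //; case: least_singular_value_has_inf.
Qed.

Variable xi : R.
Hypothesis xi_gt0 : 0 < xi.
Hypothesis gram_ge : loewner_le xi%:M (A *m A^T).

Let gram_eigenvalue_ge a : eigenvalue (A *m A^T) a -> xi <= a.
Proof.
move=> /(eigenvalue_sym gram_sym)[u u0 Au].
have uu0 : 0 < dot u u by rewrite -norm2_sqr exprn_gt0 // norm2_gt0.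
have := gram_ge u; rewrite mulmxBl Au mul_scalar_mx -scalerBl dotZr.
by rewrite pmulr_lge0 // subr_ge0.
Qed.

Lemma sqrt_le_least_singular_value : Num.sqrt xi <= least_singular_value A.
Proof.
apply: lb_le_inf; first by case: least_singular_value_has_inf.
move=> s [s0 /gram_eigenvalue_ge h].
by rewrite -[leRHS](ger0_norm s0) -sqrtr_sqr ler_sqrt // sqr_ge0.
Qed.

Lemma gram_unitmx : A *m A^T \in unitmx.
Proof.
apply: contraT => nu.
have /gram_eigenvalue_ge : eigenvalue (A *m A^T) 0.
  by apply: eigenvalue_non_unit; rewrite raddf0 subr0.
by rewrite leNgt xi_gt0.
Qed.

End LeastSingularValue.

(** The saddle-point matrix (B A^T; A 0) is bounded below. Write the first block
    as p0 + A^T w with A p0 = 0: the second equation controls A^T w, coercivity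
    of B on the kernel of A then controls p0, and the first equation controls
    A^T v, hence v. The three estimates add up to the constant 7; 20 is the
    constant in the definition of [Psi]. *)
Lemma saddle_lower_bound n m (B : 'M[R]_n) (A : 'M[R]_(m, n))
    (b x s : R) (p : 'cV[R]_n) (v : 'cV[R]_m) :
  A *m A^T \in unitmx ->
  1 <= b -> 0 < x -> x <= 1 -> 0 < s -> s <= 1 ->
  (forall u, norm2 (B *m u) <= b * norm2 u) ->
  (forall u, A *m u = 0 -> x * norm2 u ^+ 2 <= dot u (B *m u)) ->
  (forall u, s * norm2 u <= norm2 (A^T *m u)) ->
  norm2 (col_mx p v) <= 20 * b ^+ 2 / (x * s ^+ 2) *
    norm2 (col_mx (B *m p + A^T *m v) (A *m p)).
Proof.
move=> uA b1 x0 x1 s0 s1 hb hx hs.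
set a := B *m p + A^T *m v; set e := A *m p.
set N := norm2 (col_mx a e).
have N0 : 0 <= N := norm2_ge0 _.
have aN : norm2 a <= N.
  rewrite -(ler_pXn2r (isT : (0 < 2)%N)) ?nnegrE ?norm2_ge0 //.
  by rewrite norm2_col_mx lerDl sqr_ge0.
have eN : norm2 e <= N.
  rewrite -(ler_pXn2r (isT : (0 < 2)%N)) ?nnegrE ?norm2_ge0 //.
  by rewrite norm2_col_mx lerDr sqr_ge0.
pose w := invmx (A *m A^T) *m e.
have Aw : A *m (A^T *m w) = e by rewrite 2!mulmxA mulmxV // mul1mx.
set p1 := A^T *m w in Aw; set p0 := p - p1.
have Ap0 : A *m p0 = 0 by rewrite mulmxBr Aw subrr.
have p1N : s * norm2 p1 <= N.
  have h1 : norm2 p1 ^+ 2 <= norm2 w * norm2 e.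
    rewrite norm2_sqr dot_mulmx trmxK Aw.
    exact: le_trans (ler_norm _) (dot_le _ _).
  have h2 := hs w; rewrite -/p1 in h2.
  have := norm2_ge0 p1; rewrite le_eqVlt => /predU1P[<-|p1_gt0].
    by rewrite mulr0.
  rewrite -(ler_pM2r p1_gt0).
  have : s * norm2 p1 ^+ 2 <= s * norm2 w * norm2 e.
    by rewrite -mulrA ler_wpM2l // ltW.
  have : s * norm2 w * norm2 e <= norm2 p1 * N.
    by apply: ler_pM; rewrite ?mulr_ge0 ?norm2_ge0 // ltW.
  by lra.
have p0N : x * norm2 p0 <= N + b * norm2 p1.
  have Bp : B *m p0 = a - A^T *m v - B *m p1.
    by rewrite mulmxBr /a addrK.
  have := hx _ Ap0; rewrite Bp !dotBr.
  have -> : dot p0 (A^T *m v) = 0.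
    by rewrite dotC dot_mulmx trmxK Ap0 dotC dot0l.
  have := ler_norm (dot p0 a); have := dot_le p0 a.
  have := ler_norm (- dot p0 (B *m p1)); have := dot_le p0 (B *m p1).
  rewrite normrN => h1 h2 h3 h4 h5.
  have h6 : norm2 p0 * norm2 (B *m p1) <= norm2 p0 * (b * norm2 p1).
    by rewrite ler_wpM2l ?norm2_ge0.
  have h7 : norm2 p0 * norm2 a <= norm2 p0 * N.
    by rewrite ler_wpM2l ?norm2_ge0.
  have := norm2_ge0 p0; rewrite le_eqVlt => /predU1P[<-|p0_gt0].
    by rewrite mulr0 addr_ge0 // mulr_ge0 ?norm2_ge0 //; lra.
  by rewrite -(ler_pM2l p0_gt0); lra.
have pN : norm2 p <= norm2 p0 + norm2 p1.
  by rewrite -{1}(subrK p1 p) norm2D.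
have vN : s * norm2 v <= N + b * norm2 p.
  apply: le_trans (hs v) _.
  have -> : A^T *m v = a - B *m p by rewrite /a addrC addKr.
  apply: le_trans (norm2B _ _) _.
  by apply: lerD.
have cN : norm2 (col_mx p v) <= norm2 p + norm2 v.
  rewrite -(ler_pXn2r (isT : (0 < 2)%N)) ?nnegrE ?addr_ge0 ?norm2_ge0 //.
  rewrite norm2_col_mx; have := norm2_ge0 p; have := norm2_ge0 v; nra.
apply: le_trans cN _.
rewrite mulrAC ler_pdivlMr ?mulr_gt0 ?exprn_gt0 //.
have s0' := ltW s0; have x0' := ltW x0.
have b0 : 0 <= b by lra.
have bN : N <= b * N by rewrite ler_peMl.
have bbN : b * N <= b ^+ 2 * N by rewrite expr2 -mulrA ler_peMl // mulr_ge0.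
have xsp : x * s * norm2 p <= 3 * (b * N).
  have h1 : s * (x * norm2 p0) <= s * (N + b * norm2 p1) by rewrite ler_wpM2l.
  have h2 : b * (s * norm2 p1) <= b * N by rewrite ler_wpM2l.
  have h3 : x * (s * norm2 p1) <= N.
    by apply: le_trans p1N; rewrite ler_piMl // mulr_ge0 ?norm2_ge0.
  have h4 : x * s * norm2 p <= x * s * (norm2 p0 + norm2 p1).
    by rewrite ler_wpM2l // mulr_ge0.
  have h5 : s * N <= N by rewrite ler_piMl.
  by lra.
have xssv : x * s * (s * norm2 v) <= N + 3 * (b ^+ 2 * N).
  have h1 : x * s * (s * norm2 v) <= x * s * (N + b * norm2 p).
    by rewrite ler_wpM2l // mulr_ge0.
  have h2 : b * (x * s * norm2 p) <= b * (3 * (b * N)) by rewrite ler_wpM2l.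
  have h3 : x * s * N <= N by rewrite ler_piMl // mulr_ile1.
  by rewrite expr2; lra.
have xssp : s * (x * s * norm2 p) <= 3 * (b * N).
  by apply: le_trans xsp; rewrite ler_piMl // ?mulr_ge0 ?norm2_ge0.
by rewrite expr2; rewrite expr2 in bbN xssv; lra.
Qed.

End SpectralBounds.

(** * Gradients *)

Section Gradients.
Context {R : realType}.

Lemma mx_norm_le_norm2 p (u : 'cV[R]_p) : `|u| <= norm2 u.
Proof.
rewrite /Num.Def.normr /= mx_normrE bigmax_le ?norm2_ge0 // => -[i j] _ /=.
by rewrite (ord1 j) norm2_coord.
Qed.

Lemma norm2_le_mx_norm p (u : 'cV[R]_p) : norm2 u <= p%:R * `|u|.
Proof.
apply: le_trans (norm2_le_sum u) _.
rewrite mulr_natl -[X in _ *+ X](card_ord p) -sumr_const ler_sum // => i _.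
rewrite /Num.Def.normr /= mx_normrE.
exact: (le_bigmax _ (fun ij => `|u ij.1 ij.2|) (i, 0)).
Qed.

Lemma near_norm2 p (a : 'cV[R]_p) (Q : 'cV[R]_p -> Prop) :
  (\forall y \near a, Q y) ->
  exists2 r, 0 < r & forall y, norm2 (y - a) < r -> Q y.
Proof.
move=> /nbhs_ballP[r /= r0 hr]; exists r => // y yr; apply: hr.
by rewrite -ball_normE /= distrC (le_lt_trans (mx_norm_le_norm2 _)).
Qed.

Lemma near_norm2_lt p (a : 'cV[R]_p) (r : R) : 0 < r ->
  \forall y \near a, norm2 (y - a) < r.
Proof.
move=> r0; have k0 : 0 < r / p.+1%:R by rewrite divr_gt0.
have : \forall y \near a, `|a - y| < r / p.+1%:R.
  by apply/nbhs_ballP; exists (r / p.+1%:R) => // y; rewrite -ball_normE.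
apply: filterS => y; rewrite distrC => hy.
apply: le_lt_trans (norm2_le_mx_norm _) _.
rewrite ltr_pdivlMr // mulrC in hy; apply: le_lt_trans hy.
by rewrite ler_wpM2r ?normr_ge0 // ler_nat.
Qed.

(** [grad] only collects partial derivatives; this predicate also asserts
    Frechet differentiability, so that it is stable under sums, products and
    composition and gives every directional derivative. *)
Definition has_grad p (g : 'cV[R]_p -> R) (a w : 'cV[R]_p) : Prop :=
  is_diff a g (dot w).

Section Rules.
Context {p : nat}.
Implicit Types (g h : 'cV[R]_p -> R) (a w v : 'cV[R]_p).

Lemma has_grad_differentiable g a w : has_grad g a w -> differentiable g a.
Proof. by case. Qed.

Lemma has_grad_derive g a w v : has_grad g a w -> 'D_v g a = dot w v.
Proof. by move=> [dg dgE]; rewrite deriveE // dgE. Qed.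

Lemma has_grad_is_derive g a w v : has_grad g a w -> is_derive a v g (dot w v).
Proof.
move=> hg; apply: DeriveDef (has_grad_derive v hg).
exact: diff_derivable (has_grad_differentiable hg).
Qed.

Lemma has_grad_partial g a w i : has_grad g a w -> partial i g a = w i 0.
Proof.
move=> hg; rewrite /partial (has_grad_derive _ hg) dotE (bigD1 i) //= big1.
  by rewrite !mxE !eqxx mulr1 addr0.
by move=> j /negbTE ji; rewrite !mxE ji mulr0.
Qed.

Lemma has_gradE g a w : has_grad g a w -> grad g a = w.
Proof.
by move=> hg; apply/colP => i; rewrite mxE (has_grad_partial i hg).
Qed.

Lemma differentiable_has_grad g a :
  differentiable g a -> has_grad g a (grad g a).
Proof.
move=> dg; split=> //; apply/funext => v.
rewrite {1}(matrix_sum_delta v) linear_sum dotE; apply: eq_bigr => i _.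
rewrite linear_sum big_ord1 linearZ /= mulrC !mxE; congr (_ * _).
by rewrite /partial deriveE.
Qed.

Lemma has_grad_cst k a : has_grad (fun=> k) a 0.
Proof. by apply: is_diff_eq; apply/funext => v; rewrite dot0l. Qed.

Lemma has_gradD g h a w v : has_grad g a w -> has_grad h a v ->
  has_grad (fun x => g x + h x) a (w + v).
Proof.
move=> hg hh; apply: (is_diff_eq (is_diffD hg hh)).
by apply/funext => u; rewrite dotDl.
Qed.

Lemma has_gradM g h a w v : has_grad g a w -> has_grad h a v ->
  has_grad (fun x => g x * h x) a (g a *: v + h a *: w).
Proof.
move=> hg hh; apply: (is_diff_eq (is_diffM hg hh)).
by apply/funext => u; rewrite dotDl !dotZl.
Qed.

Lemma has_gradZ k g a w : has_grad g a w ->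
  has_grad (fun x => k * g x) a (k *: w).
Proof.
move=> hg; apply: (is_diff_eq (is_diffZ k hg)).
by apply/funext => u; rewrite dotZl.
Qed.

Lemma has_grad_sum (I : Type) (s : seq I) (g : I -> 'cV[R]_p -> R)
    (w : I -> 'cV[R]_p) a :
  (forall i, has_grad (g i) a (w i)) ->
  has_grad (fun x => \sum_(i <- s) g i x) a (\sum_(i <- s) w i).
Proof.
move=> hg; elim: s => [|i s ih].
  by under eq_fun do rewrite big_nil; rewrite big_nil; exact: has_grad_cst.
by under eq_fun do rewrite big_cons; rewrite big_cons; exact: has_gradD.
Qed.

Lemma has_grad_near g a w (e : R) : 0 < e -> has_grad g a w ->
  \forall y \near a, `|g y - g a - dot w (y - a)| <= e * norm2 (y - a).
Proof.
move=> e0 [dg dgE].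
have /eqaddoP/(_ _ e0) h := diff_locally dg.
rewrite (near_shift 0 a) /=; near=> y. rewrite /= subr0 addrK.
have /le_trans : `|g (y + a) - (g a + 'd g a y)| <= e * `|y|.
  by near: y; exact: h.
by rewrite opprD addrA -dgE; apply; rewrite ler_pM2l // mx_norm_le_norm2.
Unshelve. all: by end_near. Qed.

End Rules.

Section Blocks.
Context {n m : nat}.
Implicit Types (a : 'cV[R]_(n + m)).

Lemma differentiable_usubmx a :
  differentiable (usubmx : 'cV[R]_(n + m) -> 'cV[R]_n) a.
Proof.
apply: linear_differentiable => u A /nbhs_ballP[e /= e0 eA].
apply/nbhs_ballP; exists e => //= v [_ uv]; apply: eA; split => // i j.
by apply: (le_lt_trans _ (uv (lshift m i) j)); rewrite !mxE.
Qed.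

Lemma has_grad_usubmx (g : 'cV[R]_n -> R) a w : has_grad g (usubmx a) w ->
  has_grad (fun z : 'cV[R]_(n + m) => g (usubmx z)) a (col_mx w 0).
Proof.
move=> hg; have du := differentiable_usubmx a.
have hd : is_diff a (usubmx : 'cV[R]_(n + m) -> 'cV[R]_n) usubmx.
  split=> //; rewrite diff_lin // => u.
  exact: differentiable_continuous (differentiable_usubmx u).
apply: (is_diff_eq (is_diff_comp hd hg)); apply/funext => v /=.
by rewrite -{2}(vsubmxK v) dot_col_mx dot0l addr0.
Qed.

Lemma has_grad_coord p (a : 'cV[R]_p) i :
  has_grad (fun z : 'cV[R]_p => z i 0) a (delta_mx i 0).
Proof.
suff <- : grad (fun z : 'cV[R]_p => z i 0) a = delta_mx i 0.
  exact/differentiable_has_grad/differentiable_coord.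
apply/colP => j; rewrite !mxE /partial /derive; apply: cvg_lim => //.
apply: cvg_near_cst; near=> h; rewrite /= !mxE addrK /=.
rewrite -[_ *: _]/(_ * _) mulrA mulVf ?mul1r; last first.
  by near: h; exact: nbhs_dnbhs_neq.
by rewrite eq_sym eqxx andbT; case: eqVneq.
Unshelve. all: by end_near. Qed.

End Blocks.

Lemma is_derive_line p (g : 'cV[R]_p -> R) y d (t l : R) :
  is_derive (y + t *: d) d g l -> is_derive t 1 (fun s : R => g (y + s *: d)) l.
Proof.
move=> [dg gl].
have E : (fun h : R => h^-1 *:
      (((fun s : R => g (y + s *: d)) \o shift t) (h *: 1) - g (y + t *: d))) =
    (fun h : R => h^-1 *:
      ((g \o shift (y + t *: d)) (h *: d) - g (y + t *: d))).
  apply/funext => h /=; congr (_ *: (g _ - _)).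
  by rewrite -[h *: 1]/(h * 1) mulr1 scalerDl addrCA.
by split; [rewrite /derivable E|rewrite /derive E].
Qed.

Lemma is_derive_quadratic (a b t : R) :
  is_derive t 1 (fun s : R => s * a + s ^+ 2 / 2 * b) (a + t * b).
Proof.
have -> : (fun s : R => s * a + s ^+ 2 / 2 * b) =
    a *: (id : R -> R) + (b / 2) *: ((id : R -> R) ^+ 2).
  by apply/funext => s; rewrite -[RHS]/(a * s + b / 2 * s ^+ 2); ring.
by apply: is_derive_eq; rewrite -![_ *: _]/(_ * _) /=; field.
Qed.

End Gradients.

(** * Penalizing the norm of a gradient *)

Section GradientPenalty.
Context {R : realType} {N : nat}.
Variables (Phi : 'cV[R]_N -> R) (gam : 'cV[R]_N -> 'cV[R]_N).
Variables (J : 'cV[R]_N -> 'M[R]_N) (e : 'rV[R]_N) (zs : 'cV[R]_N).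
Hypothesis Phi_grad : forall z, has_grad Phi z (gam z).
Hypothesis gam_grad :
  forall z i, has_grad (fun y => gam y i 0) z (row i (J z))^T.
Hypothesis J_cont : forall i j, J z i j @[z --> zs] --> J zs i j.
Hypothesis gam_zs : gam zs = 0.

Implicit Types (y d v h : 'cV[R]_N).

(** With Phi the Lagrangian and gam its gradient in (x, lambda), this is the
    exact augmented Lagrangian. *)
Definition penalized y : R := Phi y + \sum_i e 0 i / 2 * gam y i 0 ^+ 2.

Let E := diag_mx e.

Definition penalized_grad y : 'cV[R]_N := gam y + (J y)^T *m (E *m gam y).

(** The term with the derivative of J, present at other points, is multiplied by
    gam and vanishes at zs. *)
Definition penalized_hess : 'M[R]_N := J zs + (J zs)^T *m E *m J zs.

Lemma penalized_has_grad y : has_grad penalized y (penalized_grad y).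
Proof.
have -> : penalized_grad y = gam y +
    \sum_i (e 0 i / 2) *:
      (gam y i 0 *: (row i (J y))^T + gam y i 0 *: (row i (J y))^T).
  congr (_ + _); apply/colP => j; rewrite mxE summxE; apply: eq_bigr => i _.
  by rewrite mul_diag_mx !mxE; field.
apply: has_gradD => //; apply: has_grad_sum => i; apply: has_gradZ.
by under eq_fun do rewrite expr2; exact: has_gradM.
Qed.

Lemma gam_expansion (eps : R) : 0 < eps ->
  \forall y \near zs,
    norm2 (gam y - J zs *m (y - zs)) <= eps * norm2 (y - zs).
Proof.
move=> eps0; pose k := eps / N.+1%:R.
have k0 : 0 < k by rewrite divr_gt0.
have : \forall y \near zs, forall i,
    `|gam y i 0 - gam zs i 0 - dot (row i (J zs))^T (y - zs)| <=
    k * norm2 (y - zs).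
  by apply: (filter_forall (F := nbhs zs)) => i; exact: has_grad_near.
apply: filterS => y hy; apply: le_trans (norm2_le_sum _) _.
apply: (@le_trans _ _ (\sum_(i < N) k * norm2 (y - zs))).
  apply: ler_sum => i _; have := hy i; rewrite gam_zs.
  have -> : dot (row i (J zs))^T (y - zs) = (J zs *m (y - zs)) i 0.
    by rewrite /dot trmxK -row_mul mxE.
  by rewrite !mxE subr0.
rewrite sumr_const card_ord -mulr_natl mulrA ler_wpM2r ?norm2_ge0 //.
by rewrite /k mulrCA ler_piMr ?(ltW eps0) // ler_pdivrMr // mul1r ler_nat.
Qed.

Lemma trmx_J_near (eps : R) : 0 < eps ->
  \forall y \near zs, forall v, norm2 ((J y - J zs)^T *m v) <= eps * norm2 v.
Proof.
move=> eps0; pose k := eps / (N * N).+1%:R.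
have k0 : 0 < k by rewrite divr_gt0.
have : \forall y \near zs, forall i j, `|(J y - J zs) i j| <= k.
  apply: (filter_forall (F := nbhs zs)) => i.
  apply: (filter_forall (F := nbhs zs)) => j.
  have /cvgrPdist_le/(_ _ k0) := @J_cont i j.
  by apply: filterS => y; rewrite distrC !mxE.
apply: filterS => y hy v; apply: norm2_mulmx_small; first exact: ltW.
by move=> i j; rewrite mxE.
Qed.

(** Because gam vanishes at zs, the second derivatives of gam do not enter: the
    penalized function has a second-order expansion although gam is only
    differentiable once. *)
Lemma penalized_grad_expansion (eps : R) : 0 < eps ->
  \forall y \near zs,
    norm2 (penalized_grad y - penalized_hess *m (y - zs)) <=
    eps * norm2 (y - zs).
Proof.
move=> eps0.
pose b := opnorm (J zs)^T * opnorm E + opnorm E * (1 + opnorm (J zs)) + 1.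
have oE := opnorm_ge0 E; have oJ := opnorm_ge0 (J zs).
have oT := opnorm_ge0 (J zs)^T.
have b0 : 0 < b by rewrite /b; nra.
pose k := Num.min (eps / b) 1.
have k0 : 0 < k by rewrite lt_min ltr01 andbT divr_gt0.
have k1 : k <= 1 by rewrite ge_min lexx orbT.
have kb : k * b <= eps by rewrite -ler_pdivlMr // ge_min lexx.
near=> y.
have g1 : norm2 (gam y - J zs *m (y - zs)) <= k * norm2 (y - zs).
  by near: y; exact: gam_expansion.
have g2 v : norm2 ((J y - J zs)^T *m v) <= k * norm2 v.
  by move: v; near: y; exact: trmx_J_near.
move: (y - zs) g1 => h; set r := gam y - J zs *m h => g1.
have -> : penalized_grad y - penalized_hess *m h =
    r + ((J zs)^T *m (E *m r) + (J y - J zs)^T *m (E *m gam y)).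
  have -> : (J y - J zs)^T = (J y)^T - (J zs)^T by rewrite linearB.
  rewrite /penalized_grad /penalized_hess /r !mulmxBr [in RHS]mulmxBl.
  rewrite mulmxDl -!mulmxA !opprD addrACA; congr (_ + _).
  by rewrite [RHS]addrC subrKA.
have n0 := norm2_ge0 h.
have gy : norm2 (gam y) <= (1 + opnorm (J zs)) * norm2 h.
  rewrite -(subrK (J zs *m h) (gam y)) mulrDl mul1r.
  apply: le_trans (norm2D _ _) _; apply: lerD (norm2_mulmx _ _).
  by apply: le_trans g1 _; rewrite ler_piMl.
have t1 : norm2 ((J zs)^T *m (E *m r)) <=
    opnorm (J zs)^T * (opnorm E * (k * norm2 h)).
  apply: le_trans (norm2_mulmx _ _) _; rewrite ler_wpM2l //.
  apply: le_trans (norm2_mulmx _ _) _; exact: ler_wpM2l.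
have t2 : norm2 ((J y - J zs)^T *m (E *m gam y)) <=
    k * (opnorm E * ((1 + opnorm (J zs)) * norm2 h)).
  apply: le_trans (g2 _) _; rewrite (ler_wpM2l (ltW k0)) //.
  apply: le_trans (norm2_mulmx _ _) _; exact: ler_wpM2l.
apply: (@le_trans _ _ (k * b * norm2 h)); last by rewrite ler_wpM2r.
apply: le_trans (norm2D _ _) _.
apply: le_trans (lerD g1 (norm2D _ _)) _.
apply: le_trans (lerD (lexx _) (lerD t1 t2)) _.
by rewrite /b; lra.
Unshelve. all: by end_near. Qed.

(** Along the segment from y to y + d the function minus its quadratic model
    has derivative (gradient - A (point - zs)) . d, which is small by the
    expansion of the gradient. The mean value theorem is applied to this
    difference, and not to the function, because the factor 1/2 of the quadratic
    term matters. *)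
Lemma penalized_increment (eps : R) : 0 < eps ->
  exists2 r, 0 < r & forall y d, norm2 (y - zs) + norm2 d < r ->
  penalized (y + d) - penalized y <=
    dot (penalized_hess *m (y - zs)) d + 2^-1 * dot (penalized_hess *m d) d +
    eps * (norm2 (y - zs) + norm2 d) * norm2 d.
Proof.
move=> eps0.
have [r r0 hr] := near_norm2 (penalized_grad_expansion eps0).
exists r => // y d yd.
set A := penalized_hess in hr *; set h := y - zs in yd *.
pose a := dot (A *m h) d; pose b := dot (A *m d) d.
pose q := fun t : R => penalized (y + t *: d) - (t * a + t ^+ 2 / 2 * b).
pose dq := fun t : R =>
  dot (penalized_grad (y + t *: d)) d - (a + t * b).
have dqP (t : R) : is_derive t 1 q (dq t).
  apply: is_deriveB; last exact: is_derive_quadratic.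
  exact/is_derive_line/has_grad_is_derive/penalized_has_grad.
have qcont : {within `[0, 1], continuous q}.
  by apply: derivable_within_continuous => s _; case: (dqP s).
have [t] := MVT ltr01 (fun s _ => dqP s) qcont; rewrite in_itv /= => t01.
have /andP[/ltW t0 /ltW t1] := t01.
rewrite subr0 mulr1 /q expr0n expr1n /= scale0r scale1r addr0 => inc.
have : dq t <= eps * (norm2 h + norm2 d) * norm2 d.
  have -> : dq t = dot (penalized_grad (y + t *: d) - A *m (y + t *: d - zs)) d.
    have -> : y + t *: d - zs = h + t *: d by rewrite addrAC.
    rewrite dotBl /dq; congr (_ - _).
    by rewrite (mulmxDr A h) -scalemxAr dotDl dotZl.
  apply: le_trans (ler_norm _) _; apply: le_trans (dot_le _ _) _.
  rewrite ler_wpM2r ?norm2_ge0 //.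
  have hn : norm2 (y + t *: d - zs) <= norm2 h + norm2 d.
    rewrite addrAC; apply: le_trans (norm2D _ _) _; rewrite lerD2l norm2Z.
    by rewrite ler_piMl ?norm2_ge0 // ger0_norm.
  apply: le_trans (hr _ (le_lt_trans hn yd)) _.
  by rewrite ler_wpM2l // ltW.
by move: inc; rewrite /a /b; lra.
Qed.

End GradientPenalty.

(** * Derivatives of the Lagrangian *)

Section LagrangianDerivatives.
Context {R : realType} {n m : nat}.
Variables (f : 'cV[R]_n -> R) (c : 'cV[R]_n -> 'cV[R]_m).
Hypothesis f2 : Ck_on 2 setT f.
Hypothesis c2 : forall i : 'I_m, Ck_on 2 setT (fun x => c x i 0).

Let c_ i x : R := c x i 0.

Implicit Types (x : 'cV[R]_n) (lam : 'cV[R]_m) (z : 'cV[R]_(n + m)).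

Lemma hessE (g : 'cV[R]_n -> R) x i j :
  hess g x i j = partial i (partial j g) x.
Proof. by rewrite mxE. Qed.

Lemma C2_grad g x : Ck_on 2 setT g -> has_grad g x (grad g x).
Proof. by move=> [dg _]; exact/differentiable_has_grad/dg. Qed.

Lemma C2_partial_grad (g : 'cV[R]_n -> R) i x :
  Ck_on 2 setT g -> has_grad (partial i g) x (\col_j hess g x j i).
Proof.
move=> [_ /(_ i)[dg _]].
have <- : grad (partial i g) x = \col_j hess g x j i.
  by apply/colP => j; rewrite !mxE.
exact/differentiable_has_grad/dg.
Qed.

Lemma C2_hess_continuous (g : 'cV[R]_n -> R) i j :
  Ck_on 2 setT g -> continuous (fun x => hess g x i j).
Proof.
move=> [_ /(_ j)[_ /(_ i) hc]].
have -> : (fun x => hess g x i j) = partial i (partial j g).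
  by apply/funext => x; rewrite mxE.
exact/continuous_subspace_setT.
Qed.

Lemma C2_partial_continuous (g : 'cV[R]_n -> R) i :
  Ck_on 2 setT g -> continuous (partial i g).
Proof.
move=> hg x; apply: differentiable_continuous.
exact: has_grad_differentiable (C2_partial_grad i x hg).
Qed.

Lemma lagrangian_has_grad x lam : has_grad (lagrangian f c ^~ lam) x
  (grad f x + \sum_i lam i 0 *: grad (c_ i) x).
Proof.
have -> : lagrangian f c ^~ lam = fun y => f y + \sum_i lam i 0 * c_ i y.
  by apply/funext => y; rewrite /lagrangian dotE.
apply: has_gradD; first exact: C2_grad.
apply: (@has_grad_sum _ _ _ _ (fun i y => lam i 0 * c_ i y)) => i.
by apply: has_gradZ; exact/C2_grad/c2.
Qed.

Lemma partial_lagrangian j lam : partial j (lagrangian f c ^~ lam) =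
  fun x => partial j f x + \sum_i lam i 0 * partial j (c_ i) x.
Proof.
apply/funext => x; rewrite (has_grad_partial j (lagrangian_has_grad x lam)).
by rewrite !mxE summxE; congr (_ + _); apply: eq_bigr => i _; rewrite !mxE.
Qed.

Lemma grad_xLE x lam j : grad_xL f c x lam j 0 =
  partial j f x + \sum_i lam i 0 * partial j (c_ i) x.
Proof. by rewrite mxE partial_lagrangian. Qed.

Lemma hess_xLE x lam i j : hess_xL f c x lam i j =
  hess f x i j + \sum_k lam k 0 * hess (c_ k) x i j.
Proof.
apply: etrans (hessE _ _ _ _) _.
apply: etrans (congr1 (fun g => partial i g x) (partial_lagrangian j lam)) _.
have /(has_grad_partial i) -> : has_grad
    (fun y => partial j f y + \sum_k lam k 0 * partial j (c_ k) y) x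
    (\col_i hess f x i j + \sum_k lam k 0 *: \col_i hess (c_ k) x i j).
  apply: has_gradD; first exact: C2_partial_grad.
  apply: (@has_grad_sum _ _ _ _ (fun k y => lam k 0 * partial j (c_ k) y)) => k.
  by apply: has_gradZ; exact/C2_partial_grad/c2.
rewrite mxE [X in X + _]mxE summxE; congr (_ + _); apply: eq_bigr => k _.
by rewrite mxE [X in _ * X]mxE.
Qed.

(** The derivative of [gradL]; row i is the gradient of the i-th coordinate, so
    that the Hessian enters transposed. *)
Definition kkt_matrix z : 'M[R]_(n + m) :=
  let G := jac c (usubmx z) in
  block_mx (hess_xL f c (usubmx z) (dsubmx z))^T G^T G 0.

Lemma kkt_matrix_ul z j a : kkt_matrix z (lshift m j) (lshift m a) =
  hess_xL f c (usubmx z) (dsubmx z) a j.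
Proof. by rewrite block_mxEul; exact: mxE. Qed.

Lemma kkt_matrix_ur z j a : kkt_matrix z (lshift m j) (rshift n a) =
  partial j (c_ a) (usubmx z).
Proof. by rewrite block_mxEur; apply: etrans (mxE _ _ _ _) _; exact: mxE. Qed.

Lemma kkt_matrix_dl z j a : kkt_matrix z (rshift n j) (lshift m a) =
  partial a (c_ j) (usubmx z).
Proof. by rewrite block_mxEdl; exact: mxE. Qed.

Lemma kkt_matrix_dr z j a : kkt_matrix z (rshift n j) (rshift n a) = 0.
Proof. by rewrite block_mxEdr; exact: mxE. Qed.

Definition joint_lagrangian z : R := lagrangian f c (usubmx z) (dsubmx z).

Lemma multiplier_has_grad z i :
  has_grad (fun y : 'cV[R]_(n + m) => dsubmx y i 0) z (col_mx 0 (delta_mx i 0)).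
Proof.
have -> : (fun y : 'cV[R]_(n + m) => dsubmx y i 0) = fun y => y (rshift n i) 0.
  by apply/funext => y; rewrite mxE.
have -> : col_mx 0 (delta_mx i 0) = delta_mx (rshift n i) 0 :> 'cV[R]_(n + m).
  apply/colP => k; rewrite mxE; case: split_ordP => j ->; rewrite !mxE.
    by rewrite eq_lrshift.
  by rewrite eq_rshift.
exact: has_grad_coord.
Qed.

Lemma joint_lagrangian_has_grad z :
  has_grad joint_lagrangian z (gradL f c z).
Proof.
set x := usubmx z; set lam := dsubmx z.
have -> : gradL f c z = col_mx (grad f x) 0 +
    \sum_i (lam i 0 *: col_mx (grad (c_ i) x) 0 +
            c_ i x *: col_mx 0 (delta_mx i 0)).
  rewrite big_split /=; apply/colP => k.
  rewrite [RHS]mxE [X in _ = _ + X]mxE !summxE.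
  case: (split_ordP k) => j ->.
    rewrite !col_mxEu grad_xLE mxE [X in _ + (_ + X)]big1 ?addr0 => [|i _].
      congr (_ + _); apply: eq_bigr => i _. 
      by rewrite [RHS]mxE col_mxEu [X in _ = _ * X]mxE.
    by rewrite mxE col_mxEu [X in _ * X]mxE mulr0.
  rewrite !col_mxEd mxE add0r [X in X + _]big1 => [|i _]; last first.
    by rewrite mxE col_mxEd [X in _ * X]mxE mulr0.
  rewrite add0r (bigD1 j) //= big1 => [|i /negbTE ij].
    by rewrite mxE col_mxEd [X in _ * X]mxE !eqxx mulr1 addr0.
  by rewrite mxE col_mxEd [X in _ * X]mxE eq_sym ij mulr0.
have -> : joint_lagrangian =
    fun y => f (usubmx y) + \sum_i dsubmx y i 0 * c_ i (usubmx y).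
  by apply/funext => y; rewrite /joint_lagrangian /lagrangian dotE.
apply: has_gradD; first exact/has_grad_usubmx/C2_grad.
apply: (@has_grad_sum _ _ _ _ (fun i y => dsubmx y i 0 * c_ i (usubmx y))) => i.
apply: has_gradM (multiplier_has_grad z i) _.
exact/(@has_grad_usubmx _ _ _ (c_ i))/C2_grad/c2.
Qed.

Lemma gradL_has_grad z i :
  has_grad (fun y => gradL f c y i 0) z (row i (kkt_matrix z))^T.
Proof.
set x := usubmx z; set lam := dsubmx z.
case: (split_ordP i) => j ->.
  have -> : (fun y => gradL f c y (lshift m j) 0) = fun y =>
      partial j f (usubmx y) +
      \sum_k dsubmx y k 0 * partial j (c_ k) (usubmx y).
    by apply/funext => y; rewrite col_mxEu grad_xLE.
  have -> : (row (lshift m j) (kkt_matrix z))^T =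
      col_mx (\col_a hess f x a j) 0 +
      \sum_k (lam k 0 *: col_mx (\col_a hess (c_ k) x a j) 0 +
              partial j (c_ k) x *: col_mx 0 (delta_mx k 0)).
    rewrite big_split /=; apply/colP => k.
    rewrite [RHS]mxE [X in _ = _ + X]mxE !summxE [LHS]mxE [LHS]mxE.
    case: (split_ordP k) => a ->.
      rewrite kkt_matrix_ul [LHS]hess_xLE col_mxEu [X in _ = X + _]mxE.
      rewrite [X in _ = _ + (_ + X)]big1 ?addr0 => [|i' _].
        congr (_ + _); apply: eq_bigr => i' _.
        by rewrite [RHS]mxE col_mxEu [X in _ = _ * X]mxE.
      by rewrite mxE col_mxEu [X in _ * X]mxE mulr0.
    rewrite kkt_matrix_ur col_mxEd [X in _ = X + _]mxE add0r.
    rewrite [X in _ = X + _]big1 => [|i' _]; last first.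
      by rewrite mxE col_mxEd [X in _ * X]mxE mulr0.
    rewrite add0r (bigD1 a) //= big1 => [|i' /negbTE ik].
      by rewrite mxE col_mxEd [X in _ * X]mxE !eqxx mulr1 addr0.
    by rewrite mxE col_mxEd [X in _ * X]mxE eq_sym ik mulr0.
  apply: has_gradD; first exact/has_grad_usubmx/C2_partial_grad.
  apply: (@has_grad_sum _ _ _ _
    (fun k y => dsubmx y k 0 * partial j (c_ k) (usubmx y))) => k.
  apply: has_gradM (multiplier_has_grad z k) _.
  exact/(@has_grad_usubmx _ _ _ (partial j (c_ k)))/C2_partial_grad/c2.
have -> : (fun y => gradL f c y (rshift n j) 0) = fun y => c_ j (usubmx y).
  by apply/funext => y; rewrite col_mxEd.
have -> : (row (rshift n j) (kkt_matrix z))^T = col_mx (grad (c_ j) x) 0.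
  apply/colP => k; rewrite [LHS]mxE [LHS]mxE; case: (split_ordP k) => a ->.
    by rewrite kkt_matrix_dl col_mxEu [RHS]mxE.
  by rewrite kkt_matrix_dr col_mxEd mxE.
exact/(@has_grad_usubmx _ _ _ (c_ j))/C2_grad/c2.
Qed.

(** The entries of gradL are those of grad_xL, penalized with weight e2,
    followed by those of c, penalized with weight e1. *)
Lemma auglag_penalized e1 e2 : auglag f c e1 e2 =
  penalized joint_lagrangian (gradL f c) (row_mx (const_mx e2) (const_mx e1)).
Proof.
apply/funext => z; rewrite /auglag /penalized -addrA; congr (_ + _).
rewrite big_split_ord /= addrC; congr (_ + _); rewrite norm2_sqr dotE mulr_sumr.
  by apply: eq_bigr => i _; rewrite row_mxEl col_mxEu !mxE expr2.
by apply: eq_bigr => i _; rewrite row_mxEr col_mxEd !mxE expr2.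
Qed.

Let lincomb_cvg (T : Type) (F : set_system T) {FF : Filter F} (a : T -> R) a0
    (b d : 'I_m -> T -> R) (b0 d0 : 'I_m -> R) :
  a x @[x --> F] --> a0 -> (forall k, b k x @[x --> F] --> b0 k) ->
  (forall k, d k x @[x --> F] --> d0 k) ->
  a x + \sum_k b k x * d k x @[x --> F] --> a0 + \sum_k b0 k * d0 k.
Proof.
move=> ha hb hd; apply: cvgD => //; apply: cvg_big => [|k _].
  exact: add_continuous.
exact: cvgM.
Qed.

Let comp_usubmx_cvg (g : 'cV[R]_n -> R) z0 : continuous g ->
  g (usubmx z) @[z --> z0] --> g (usubmx z0).
Proof.
move=> gc; apply: (@continuous_comp _ _ _ usubmx g); last exact: gc.
exact: differentiable_continuous (differentiable_usubmx z0).
Qed.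

Lemma hess_xL_cvg z0 i j :
  hess_xL f c (usubmx z) (dsubmx z) i j @[z --> z0] -->
  hess_xL f c (usubmx z0) (dsubmx z0) i j.
Proof.
have E z : hess_xL f c (usubmx z) (dsubmx z) i j = hess f (usubmx z) i j +
    \sum_(k < m) dsubmx z k 0 * hess (c_ k) (usubmx z) i j.
  exact: hess_xLE.
rewrite [in X in _ --> X]E (funext E).
have Hf : hess f (usubmx z) i j @[z --> z0] --> hess f (usubmx z0) i j.
  exact/(@comp_usubmx_cvg (fun x => hess f x i j))/C2_hess_continuous.
have Hc k : hess (c_ k) (usubmx z) i j @[z --> z0] -->
    hess (c_ k) (usubmx z0) i j.
  exact/(@comp_usubmx_cvg (fun x => hess (c_ k) x i j))/C2_hess_continuous/c2.
have Hl k : dsubmx z k 0 @[z --> z0] --> (dsubmx z0 k 0 : R).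
  exact/differentiable_continuous/has_grad_differentiable/multiplier_has_grad.
exact: (lincomb_cvg (F := nbhs z0) Hf Hl Hc).
Qed.

Let partial_c_cvg z0 i j :
  partial j (c_ i) (usubmx z) @[z --> z0] --> partial j (c_ i) (usubmx z0).
Proof. exact/comp_usubmx_cvg/C2_partial_continuous/c2. Qed.

Lemma kkt_matrix_cvg z0 i j :
  kkt_matrix z i j @[z --> z0] --> kkt_matrix z0 i j.
Proof.
case: (split_ordP i) => i' ->; case: (split_ordP j) => j' ->.
- rewrite kkt_matrix_ul; under eq_fun do rewrite kkt_matrix_ul.
  exact: hess_xL_cvg.
- rewrite kkt_matrix_ur; under eq_fun do rewrite kkt_matrix_ur.
  exact: partial_c_cvg.
- rewrite kkt_matrix_dl; under eq_fun do rewrite kkt_matrix_dl.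
  exact: partial_c_cvg.
- rewrite kkt_matrix_dr; under eq_fun do rewrite kkt_matrix_dr.
  exact: (@cvg_cst _ _ _ (nbhs z0)).
Qed.

End LagrangianDerivatives.

(** * One inexact Newton step *)

Section InexactNewtonStep.
Context {R : realType} {N : nat}.
Variables (Gm J : 'M[R]_N) (h d g : 'cV[R]_N) (psi kappa eps : R).
Hypothesis psi_gt0 : 0 < psi.
Hypothesis Gm_lower : forall u, norm2 u <= psi * norm2 (Gm *m u).
Hypothesis Gm_cond : 1 <= opnorm Gm * psi.
Hypothesis eps_ge0 : 0 <= eps.
Hypothesis g_model : norm2 (g - J *m h) <= eps * norm2 h.
Hypothesis Gm_model : forall v, norm2 ((Gm - J) *m v) <= eps * norm2 v.
Hypothesis kappa_ge0 : 0 <= kappa.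
Hypothesis kappa_le1 : kappa <= 1.
Hypothesis d_accurate :
  norm2 (Gm *m d + g) <= kappa * norm2 g / (opnorm Gm * psi).

Let newton_residual : norm2 (Gm *m h - g) <= 2 * eps * norm2 h.
Proof.
have -> : Gm *m h - g = (Gm - J) *m h - (g - J *m h).
  by rewrite mulmxBl opprB addrA subrK.
have := norm2B ((Gm - J) *m h) (g - J *m h); have := Gm_model h.
by have := g_model; lra.
Qed.

(** Gm (h + d) is the residual of d plus the linearization error of g. The
    accuracy test divides by opnorm Gm, which absorbs |g| <= opnorm Gm * |h|
    up to small terms, and by psi, which absorbs the inverse of Gm. *)
Lemma inexact_newton_contraction :
  norm2 (h + d) <= (kappa + 4 * psi * eps) * norm2 h.
Proof.
have o0 : 0 < opnorm Gm.
  by rewrite -(pmulr_lgt0 _ psi_gt0); apply: lt_le_trans Gm_cond.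
have n0 := norm2_ge0 h.
have gh : norm2 g <= (opnorm Gm + 2 * eps) * norm2 h.
  have -> : g = Gm *m h - (Gm *m h - g) by rewrite subKr.
  have := newton_residual.
  by have := norm2B (Gm *m h) (Gm *m h - g); have := norm2_mulmx Gm h; lra.
have hd : norm2 (Gm *m (h + d)) <=
    kappa * norm2 g / (opnorm Gm * psi) + 2 * eps * norm2 h.
  have -> : Gm *m (h + d) = (Gm *m d + g) + (Gm *m h - g).
    by rewrite mulmxDr [RHS]addrC [Gm *m d + g]addrC subrKA.
  by apply: le_trans (norm2D _ _) _; exact: lerD.
apply: le_trans (Gm_lower _) _.
apply: le_trans (ler_wpM2l (ltW psi_gt0) hd) _; rewrite mulrDr.
have -> : psi * (kappa * norm2 g / (opnorm Gm * psi)) =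
    kappa * norm2 g / opnorm Gm.
  by field; rewrite !gt_eqF.
have : kappa * norm2 g / opnorm Gm <= (kappa + 2 * psi * eps) * norm2 h.
  rewrite ler_pdivrMr //.
  apply: le_trans (ler_wpM2l kappa_ge0 gh) _.
  have e1 : kappa * (eps * norm2 h) <= eps * norm2 h.
    by rewrite ler_piMl // mulr_ge0.
  have e2 : eps * norm2 h <= opnorm Gm * psi * (eps * norm2 h).
    by rewrite ler_peMl // mulr_ge0.
  by lra.
by lra.
Qed.

Variables (E : 'M[R]_N) (s omega bet eta : R) (gA : 'cV[R]_N).
Hypothesis s_ge0 : 0 <= s.
Hypothesis E_le : forall u, norm2 (E *m u) <= s * norm2 u.
Let A : 'M[R]_N := J + J^T *m E *m J.
Hypothesis gA_model : norm2 (gA - A *m h) <= eps * norm2 h.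
Hypothesis gA_descent : dot gA d <= - eta * norm2 g ^+ 2 / 2.
Hypothesis bet_lt : bet < 2^-1.
Hypothesis omegaE : omega = (2^-1 - bet) * eta.
Hypothesis psi_ge20 : 20 <= psi.
Hypothesis kappa_le : kappa <= omega / ((1 + s) * psi ^+ 2).
Hypothesis omega_gt0 : 0 < omega.
Hypothesis eps_psi : 4 * psi * eps <= 1.
(* The error terms of the model add up to at most
   (10 + 4 (1 + s)) psi^2 eps |g|^2, while the descent term exceeds the residual
   term by (1/2 - 1/20) omega |g|^2. *)
Hypothesis eps_omega : 56 * (1 + s) * psi ^+ 2 * eps <= omega.

(** The quadratic model satisfies the sufficient decrease condition at the unit
    step. Its increment exceeds bet * (gA . d) by
    (1/2 - bet) (gA . d) + 1/2 d . A (h + d) up to small terms, and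
    d . A (h + d) = d . J (h + d) + J d . E J (h + d) is controlled by the
    residual because J (h + d) is close to Gm d + g. The bound on kappa makes
    the residual part at most omega / psi times |g|^2, hence at most
    omega |g|^2 / 20. *)
Lemma unit_step_sufficient_decrease :
  dot (A *m h) d + 2^-1 * dot (A *m d) d + eps * (norm2 h + norm2 d) * norm2 d
  <= bet * dot gA d.
Proof.
set r := Gm *m d + g; set G := norm2 g.
have psi20 := psi_ge20; have s0 := s_ge0.
have G0 : 0 <= G := norm2_ge0 g.
have p0 := ltW psi_gt0; have h0 := norm2_ge0 h; have d0 := norm2_ge0 d.
have rk : norm2 r <= kappa * G.
  apply: le_trans d_accurate _; rewrite ler_pdivrMr; last first.
    exact: lt_le_trans Gm_cond.
  by rewrite ler_peMr // mulr_ge0.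
have rG : norm2 r <= G by apply: le_trans rk _; rewrite ler_piMl.
have dG : norm2 d <= 2 * psi * G.
  apply: le_trans (Gm_lower d) _; rewrite [2 * psi]mulrC -mulrA ler_wpM2l //.
  have -> : Gm *m d = r - g by rewrite addrK.
  by have := norm2B r g; rewrite -/G; lra.
have hG : norm2 h <= 2 * psi * G.
  have := Gm_lower h; have -> : Gm *m h = g + (Gm *m h - g) by rewrite subrKC.
  have := norm2D g (Gm *m h - g); have := newton_residual; rewrite -/G.
  move=> h1 h2 h3.
  have : norm2 h <= psi * (G + 2 * eps * norm2 h).
    by apply: le_trans h3 _; rewrite ler_wpM2l //; lra.
  have : 4 * psi * eps * norm2 h <= norm2 h by rewrite ler_piMl.
  by lra.
have JdG : norm2 (J *m d) <= 3 * G.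
  have -> : J *m d = r - g - (Gm - J) *m d.
    by rewrite mulmxBl addrK subKr.
  have := norm2B (r - g) ((Gm - J) *m d); have := norm2B r g.
  have := Gm_model d; rewrite -/G.
  have : eps * norm2 d <= eps * (2 * psi * G) by rewrite ler_wpM2l.
  have : 4 * psi * eps * G <= G by rewrite ler_piMl.
  by lra.
set q := (J *m h - g) - (Gm - J) *m d.
have qG : norm2 q <= 4 * psi * eps * G.
  have := norm2B (J *m h - g) ((Gm - J) *m d); have := Gm_model d.
  have := g_model; rewrite -(norm2N (g - _)) opprB -/q.
  have : eps * norm2 d <= eps * (2 * psi * G) by rewrite ler_wpM2l.
  have : eps * norm2 h <= eps * (2 * psi * G) by rewrite ler_wpM2l.
  by lra.
have Jhd : J *m (h + d) = r + q.
  rewrite /r /q mulmxDr mulmxBl opprB [RHS]addrACA [Gm *m d + _]addrC.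
  by rewrite [RHS]addrACA subrK subrKC.
have Ahd : dot (A *m (h + d)) d <=
    (norm2 r + norm2 q) * (norm2 d + s * norm2 (J *m d)).
  rewrite /A mulmxDl -!mulmxA Jhd dotDl dot_mulmx trmxK.
  have rq := norm2D r q.
  have e1 : dot (r + q) d <= (norm2 r + norm2 q) * norm2 d.
    apply: le_trans (ler_norm _) _; apply: le_trans (dot_le _ _) _.
    exact: ler_wpM2r.
  have e2 : dot (E *m (r + q)) (J *m d) <=
      (norm2 r + norm2 q) * (s * norm2 (J *m d)).
    apply: le_trans (ler_norm _) _; apply: le_trans (dot_le _ _) _.
    rewrite mulrA ler_wpM2r ?norm2_ge0 // mulrC.
    by apply: le_trans (E_le _) _; rewrite ler_wpM2l.
  by rewrite mulrDr; exact: lerD.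
have step : norm2 d + s * norm2 (J *m d) <= 2 * psi * G * (1 + s).
  have : s * norm2 (J *m d) <= s * (2 * psi * G).
    rewrite ler_wpM2l //; apply: le_trans JdG _; rewrite ler_wpM2r //; lra.
  by lra.
have step0 : 0 <= norm2 d + s * norm2 (J *m d).
  by rewrite addr_ge0 // mulr_ge0 ?norm2_ge0.
have rstep : norm2 r * (norm2 d + s * norm2 (J *m d)) <= omega / 10 * G ^+ 2.
  apply: (@le_trans _ _ (kappa * G * (2 * psi * G * (1 + s)))).
    by apply: ler_pM; rewrite ?norm2_ge0.
  have : kappa * ((1 + s) * psi ^+ 2) <= omega.
    by rewrite -ler_pdivlMr // mulr_gt0 ?exprn_gt0 //; lra.
  move=> kp; have kp' : 20 * (kappa * (psi * (1 + s))) <= omega.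
    apply: le_trans kp; rewrite expr2.
    have : 0 <= (psi - 20) * (kappa * (psi * (1 + s))).
      by rewrite !mulr_ge0 //; lra.
    by lra.
  have : 20 * (kappa * (psi * (1 + s))) * G ^+ 2 <= omega * G ^+ 2.
    by rewrite ler_wpM2r // sqr_ge0.
  by lra.
have qstep : norm2 q * (norm2 d + s * norm2 (J *m d)) <=
    8 * (1 + s) * psi ^+ 2 * eps * G ^+ 2.
  apply: (@le_trans _ _ (4 * psi * eps * G * (2 * psi * G * (1 + s)))).
    by apply: ler_pM; rewrite ?norm2_ge0.
  by lra.
have hd : norm2 h * norm2 d <= 4 * psi ^+ 2 * G ^+ 2.
  apply: (@le_trans _ _ (2 * psi * G * (2 * psi * G))); last by lra.
  exact: ler_pM.
have dd : norm2 d * norm2 d <= 4 * psi ^+ 2 * G ^+ 2.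
  apply: (@le_trans _ _ (2 * psi * G * (2 * psi * G))); last by lra.
  exact: ler_pM.
have lin : dot (A *m h - gA) d <= eps * (norm2 h * norm2 d).
  apply: le_trans (ler_norm _) _; apply: le_trans (dot_le _ _) _.
  by rewrite mulrA ler_wpM2r // -norm2N opprB.
have desc : (2^-1 - bet) * dot gA d <= - omega / 2 * G ^+ 2.
  have : (2^-1 - bet) * dot gA d <= (2^-1 - bet) * (- eta * norm2 g ^+ 2 / 2).
    by rewrite ler_wpM2l // subr_ge0 ltW.
  by rewrite omegaE -/G; lra.
have ehd : eps * (norm2 h * norm2 d) <= eps * (4 * psi ^+ 2 * G ^+ 2).
  by rewrite ler_wpM2l.
have edd : eps * (norm2 d * norm2 d) <= eps * (4 * psi ^+ 2 * G ^+ 2).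
  by rewrite ler_wpM2l.
have eom : 56 * (1 + s) * psi ^+ 2 * eps * G ^+ 2 <= omega * G ^+ 2.
  by rewrite ler_wpM2r // sqr_ge0.
have sG : 0 <= s * psi ^+ 2 * eps * G ^+ 2 by rewrite !mulr_ge0 ?sqr_ge0.
have eG : 0 <= psi ^+ 2 * eps * G ^+ 2 by rewrite !mulr_ge0 ?sqr_ge0.
have oG : 0 <= omega * G ^+ 2 by rewrite mulr_ge0 ?sqr_ge0 // ltW.
move: lin Ahd; rewrite dotBl mulmxDr dotDl mulrDl => lin Ahd.
by lra.
Qed.

End InexactNewtonStep.

(** * The constant Psi and the parameter updates *)

Section PsiBounds.
Context {R : realType} {n m : nat}.
Variables (c : 'cV[R]_n -> 'cV[R]_m) (inp : adasketch_input R n m).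
Variables (z : 'cV[R]_(n + m)) (B : 'M[R]_n) (xiG : R).
Let G := jac c (usubmx z).
Hypothesis m_gt0 : (0 < m)%N.
Hypothesis xiB_gt0 : 0 < xiB inp.
Hypothesis xiG_gt0 : 0 < xiG.
Hypothesis G_gram : loewner_le xiG%:M (G *m G^T).
Hypothesis B_coercive : forall u, G *m u = 0 ->
  xiB inp * norm2 u ^+ 2 <= dot u (B *m u).

Lemma sqr_max1 (a : R) : 0 <= a -> Num.max (a ^+ 2) 1 = Num.max a 1 ^+ 2.
Proof.
move=> a0; have [a1|a1] := leP a 1.
  by rewrite max_r ?expr_le1 // expr1n.
by rewrite max_l // expr_ge1 // ltW.
Qed.

Lemma sqr_min1 (a : R) : 0 <= a -> Num.min (a ^+ 2) 1 = Num.min a 1 ^+ 2.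
Proof.
move=> a0; have [a1|a1] := leP a 1.
  by rewrite min_l ?expr_le1.
by rewrite min_r ?expr1n // expr_ge1 // ltW.
Qed.

Let sigma := least_singular_value G.

Let sigma_gt0 : 0 < sigma.
Proof.
apply: (lt_le_trans _ (sqrt_le_least_singular_value m_gt0 G_gram)).
by rewrite sqrtr_gt0.
Qed.

Let s := Num.min sigma 1.
Let x := Num.min (xiB inp) 1.
Let b := Num.max (opnorm B) 1.

Let s_gt0 : 0 < s. Proof. by rewrite lt_min sigma_gt0 ltr01. Qed.
Let s_le1 : s <= 1. Proof. by rewrite ge_min lexx orbT. Qed.
Let x_gt0 : 0 < x. Proof. by rewrite lt_min xiB_gt0 ltr01. Qed.
Let x_le1 : x <= 1. Proof. by rewrite ge_min lexx orbT. Qed.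
Let b_ge1 : 1 <= b. Proof. by rewrite le_max lexx orbT. Qed.

Let PsiE : Psi c inp z B = 20 * b ^+ 2 / (x * s ^+ 2).
Proof. by rewrite /Psi sqr_max1 ?opnorm_ge0 // sqr_min1 // ltW. Qed.

Lemma Psi_ge20 : 20 <= Psi c inp z B.
Proof.
rewrite PsiE ler_pdivlMr ?mulr_gt0 ?exprn_gt0 //.
rewrite ler_wpM2l // (@le_trans _ _ 1) ?expr_ge1 ?(le_trans ler01) //.
by rewrite mulr_ile1 ?expr_le1 ?exprn_ge0 // ltW.
Qed.

Lemma Psi_lower_bound u : norm2 u <= Psi c inp z B * norm2 (Gam c z B *m u).
Proof.
rewrite PsiE -(vsubmxK u) /Gam mul_block_col mul0mx addr0.
apply: saddle_lower_bound => //.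
- exact: gram_unitmx G_gram.
- move=> v; apply: le_trans (norm2_mulmx _ _) _.
  by rewrite ler_wpM2r ?norm2_ge0 // le_max lexx.
- move=> v /B_coercive; apply: le_trans; rewrite ler_wpM2r ?sqr_ge0 //.
  by rewrite ge_min lexx.
- move=> v; apply: (le_trans _ (least_singular_value_le _ m_gt0 _)).
  by rewrite ler_wpM2r ?norm2_ge0 // ge_min lexx.
Qed.

Lemma Psi_opnorm_ge1 : 1 <= opnorm (Gam c z B) * Psi c inp z B.
Proof.
have [u u0] : exists u : 'cV[R]_(n + m), u != 0.
  exists (delta_mx (rshift n (Ordinal m_gt0)) 0); apply/eqP => /colP.
  by move/(_ (rshift n (Ordinal m_gt0)))/eqP; rewrite !mxE !eqxx oner_eq0.
have nu := norm2_gt0 u0.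
rewrite -(ler_pM2r nu) mul1r; apply: le_trans (Psi_lower_bound u) _.
rewrite [leRHS]mulrAC [leLHS]mulrC ler_wpM2r ?norm2_mulmx //.
by apply: (le_trans _ Psi_ge20).
Qed.

(** Along the iterates this bounds Psi by a constant, which makes the small
    terms of the analysis uniform in the iteration. *)
Lemma Psi_le UpsB : opnorm B <= UpsB ->
  Psi c inp z B <= 20 * Num.max UpsB 1 ^+ 2 / (x * Num.min xiG 1).
Proof.
move=> Bb; rewrite PsiE; apply: ler_pM.
- by rewrite mulr_ge0 ?exprn_ge0 // (le_trans ler01).
- by rewrite invr_ge0 mulr_ge0 ?exprn_ge0 // ltW.
- rewrite ler_wpM2l // lerXn2r ?nnegrE ?(le_trans ler01) //.
    by rewrite le_max lexx orbT.
  by rewrite ge_max !le_max Bb lexx orbT.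
rewrite lef_pV2 ?posrE ?mulr_gt0 ?exprn_gt0 // ?lt_min ?xiG_gt0 ?ltr01 //.
rewrite ler_wpM2l ?(ltW x_gt0) //.
rewrite -sqr_min1 ?(ltW sigma_gt0) // le_min !ge_min lexx orbT andbT.
have := sqrt_le_least_singular_value m_gt0 G_gram.
move=> h; apply/orP; left.
rewrite -[xiG]sqr_sqrtr ?(ltW xiG_gt0) //.
by rewrite lerXn2r ?nnegrE ?sqrtr_ge0 // (ltW sigma_gt0).
Qed.

End PsiBounds.

Section SearchInvariant.
Context {R : realType} {n m : nat}.
Variables (f : 'cV[R]_n -> R) (c : 'cV[R]_n -> 'cV[R]_m).
Variable inp : adasketch_input R n m.

Definition admissible (t : tuning R) : Prop :=
  [/\ 0 < eta1 t, 0 < eta2 t, 0 < delta t & delta t < 1].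

Section OneSearch.
Variables (z : 'cV[R]_(n + m)) (B : 'M[R]_n).
Hypothesis beta_lt : beta inp < 2^-1.
Hypothesis nu_gt1 : 1 < nu inp.
Hypothesis Psi_gt0 : 0 < Psi c inp z B.

Lemma Ups_ge1 : 1 <= Ups f c z.
Proof. by rewrite le_max lexx orbT. Qed.

Lemma delta_trial_gt0 e1 e2 : 0 < e1 -> 0 < e2 ->
  0 < delta_trial f c inp z B e1 e2.
Proof.
move=> e10 e20; have U0 := lt_le_trans ltr01 Ups_ge1.
apply: divr_gt0; first by rewrite mulr_gt0 ?subr_gt0.
apply: mulr_gt0; last exact: exprn_gt0.
by apply: mulr_gt0; [rewrite !addr_gt0|exact: exprn_gt0].
Qed.

(** The denominator of [delta_trial] also has the factor Ups^2, which is at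
    least 1. *)
Lemma delta_trial_le e1 e2 : 0 < e1 -> 0 < e2 ->
  delta_trial f c inp z B e1 e2 <=
  (2^-1 - beta inp) * e2 / ((1 + (e1 + e2)) * Psi c inp z B ^+ 2).
Proof.
move=> e10 e20; have U0 := lt_le_trans ltr01 Ups_ge1.
have d0 : 0 < 1 + (e1 + e2) by rewrite !addr_gt0.
have num0 : 0 <= (2^-1 - beta inp) * e2.
  by rewrite mulr_ge0 ?subr_ge0 ?(ltW e20) ?(ltW beta_lt).
rewrite /delta_trial -addrA (ler_wpM2l num0) //.
have P0 : 0 < Psi c inp z B ^+ 2 by rewrite exprn_gt0.
have DU0 : 0 < (1 + (e1 + e2)) * Ups f c z ^+ 2.
  by rewrite mulr_gt0 // exprn_gt0.
rewrite lef_pV2 ?posrE ?(mulr_gt0 DU0 P0) ?(mulr_gt0 d0 P0) //.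
rewrite ler_wpM2r ?(ltW P0) // ler_peMr ?(ltW d0) //.
by rewrite expr_ge1 ?(ltW U0) // Ups_ge1.
Qed.

Definition search_invariant (t : tuning R) : Prop :=
  admissible t /\ delta t <= delta_trial f c inp z B (eta1 t) (eta2 t).

Lemma tuning_start_invariant t : admissible t ->
  search_invariant (tuning_start f c inp z B t).
Proof.
case=> e1 e2 d0 d1; split; last by rewrite /= ge_min lexx orbT.
by split=> //=; rewrite ?lt_min ?gt_min ?d0 ?d1 ?delta_trial_gt0.
Qed.

Lemma tuning_update_invariant t : admissible t ->
  search_invariant (tuning_update f c inp z B t).
Proof.
case=> e1 e2 d0 d1; have nu0 := lt_trans ltr01 nu_gt1.
have e1' : 0 < eta1 t * nu inp ^+ 2 by rewrite mulr_gt0 ?exprn_gt0.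
have e2' : 0 < eta2 t / nu inp by rewrite divr_gt0.
split; last by rewrite /= ge_min lexx orbT.
split=> //=; first by rewrite lt_min delta_trial_gt0 // divr_gt0 ?exprn_gt0.
rewrite gt_min; apply/orP; left; apply: le_lt_trans d1.
by rewrite ler_pdivrMr ?exprn_gt0 // ler_peMr ?(ltW d0) // expr_ge1 // ltW.
Qed.

Lemma search_returns_invariant theta S t0 d t : admissible t0 ->
  search_returns f c inp theta z B S t0 d t -> search_invariant t.
Proof.
move=> /tuning_start_invariant h0 [N [_ <- _ _]].
elim: N => [//|N]; rewrite iterS; case: (iter _ _ _) => d' j t' /= ih.
case: ifP => // _; case: ifP => // _ /=.
by apply: tuning_update_invariant; case: ih.
Qed.

End OneSearch.
End SearchInvariant.

(** * Local convergence along one sample path *)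

Lemma cvg_seq_ext (R : realType) (u v : nat -> R) (l : R) : u =1 v ->
  v k @[k --> \oo] --> l -> u k @[k --> \oo] --> l.
Proof. by move=> /funext ->. Qed.

Section LocalConvergence.
Context {R : realType} {n m : nat}.
Variables (f : 'cV[R]_n -> R) (c : 'cV[R]_n -> 'cV[R]_m).
Hypothesis m_gt0 : (0 < m)%N.
Hypothesis f2 : Ck_on 2 setT f.
Hypothesis c2 : forall i : 'I_m, Ck_on 2 setT (fun x => c x i 0).
Variable inp : adasketch_input R n m.
Hypothesis inp_valid : valid_input inp.
Variable theta : R.
Hypothesis theta_const : theta_seq inp = fun=> theta.
Variables (B : nat -> 'M[R]_n) (S : nat -> nat -> sketch R (n + m)).
Variables (z : nat -> 'cV[R]_(n + m)) (par : nat -> tuning R).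
Variables (dz : nat -> 'cV[R]_(n + m)) (alpha : nat -> R).
Hypothesis run : adasketch_run f c inp B S z par dz alpha.
Variables (xs : 'cV[R]_n) (lams : 'cV[R]_m).
Hypothesis c_xs : c xs = 0.
Hypothesis mult : lagrange_multiplier f c xs lams.
Variables (xiG UpsB : R).
Hypothesis xiG_gt0 : 0 < xiG.
Hypothesis G_gram : forall k, let G := jac c (usubmx (z k)) in
  loewner_le xiG%:M (G *m G^T).
Hypothesis B_coercive : forall k u, jac c (usubmx (z k)) *m u = 0 ->
  xiB inp * norm2 u ^+ 2 <= dot u (B k *m u).
Hypothesis B_bounded : forall k, opnorm (B k) <= UpsB.
Hypothesis B_consistent :
  opnorm (hess_xL f c (usubmx (z k)) (dsubmx (z k)) - B k) @[k --> \oo]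
    --> (0 : R).
Hypothesis z_cvg : z @ \oo --> col_mx xs lams.
Variable K : nat.
Hypothesis par_stable : forall k, (K <= k)%N -> par k = par K.

Let zs := col_mx xs lams.

Let xiB_gt0 : 0 < xiB inp. Proof. by case: inp_valid. Qed.
Let beta_lt : beta inp < 2^-1. Proof. by case: inp_valid => _ _ _ []. Qed.
Let nu_gt1 : 1 < nu inp. Proof. by case: inp_valid => _ _ _ _ []. Qed.
Let theta_bounds : 0 < theta /\ theta <= 1.
Proof. by case: inp_valid => _ /(_ 0%N); rewrite theta_const. Qed.

Let Psi_k k := Psi c inp (z k) (B k).
Let Psi_k_ge20 k : 20 <= Psi_k k.
Proof. exact: Psi_ge20 m_gt0 xiB_gt0 xiG_gt0 (@G_gram k). Qed.

Let par_invariant k : search_invariant f c inp (z k) (B k) (par k).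
Proof.
have Psi_gt0 k' : 0 < Psi_k k' by have := Psi_k_ge20 k'; lra.
elim: k => [|k [ih _]].
  have [_ /(_ 0%N)[_ hs _ _]] := run.
  apply: (search_returns_invariant beta_lt nu_gt1 (Psi_gt0 0%N) _ hs).
  by case: inp_valid => -[].
have [_ /(_ k.+1)[_ hs _ _]] := run.
exact: (search_returns_invariant beta_lt nu_gt1 (Psi_gt0 k.+1) ih hs).
Qed.

Lemma gradL_solution : gradL f c zs = 0.
Proof.
rewrite /gradL col_mxKu col_mxKd c_xs; apply/eqP.
rewrite col_mx_eq0 eqxx andbT; apply/eqP/colP => j.
rewrite grad_xLE // [RHS]mxE.
have hj := congr1 (fun u : 'cV[R]_n => u j 0) mult.
rewrite /= mxE [RHS]mxE in hj; rewrite -[RHS]hj.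
rewrite [grad f xs j 0]mxE; congr (_ + _); rewrite mxE; apply: eq_bigr => i _.
by rewrite [_^T _ _]mxE [jac _ _ _ _]mxE mulrC.
Qed.

Let Hs := hess_xL f c xs lams.

Lemma B_cvg i j : B k i j @[k --> \oo] --> Hs i j.
Proof.
have hH : hess_xL f c (usubmx (z k)) (dsubmx (z k)) i j @[k --> \oo] --> Hs i j.
  have := @hess_xL_cvg _ _ _ _ _ f2 c2 zs i j; rewrite col_mxKu col_mxKd.
  exact: cvg_comp z_cvg.
have hD : (hess_xL f c (usubmx (z k)) (dsubmx (z k)) - B k) i j @[k --> \oo]
    --> (0 : R).
  apply/cvgr0Pnorm_le => e e0; move/cvgr0Pnorm_le : B_consistent => /(_ _ e0).
  apply: filterS => k hk; apply: (le_trans _ hk).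
  exact: le_trans (coord_opnorm _ i j) (ler_norm _).
rewrite -[Hs i j]subr0.
by apply: cvg_seq_ext (cvgB hH hD) => k; rewrite fctE !mxE subKr.
Qed.

(** The Hessian enters the derivative of gradL transposed and Gam untransposed;
    the symmetry of B k reconciles the two in the limit. *)
Lemma Gam_near (e : R) : 0 < e -> \forall k \near \oo, forall v,
  norm2 ((Gam c (z k) (B k) - kkt_matrix f c zs) *m v) <= e * norm2 v.
Proof.
move=> e0; pose N := (n + m)%N.
have k0 : 0 < e / (N * N).+1%:R by rewrite divr_gt0.
have kkt_cvg i j :
    kkt_matrix f c (z k) i j @[k --> \oo] --> kkt_matrix f c zs i j.
  exact: cvg_comp z_cvg (@kkt_matrix_cvg _ _ _ _ _ f2 c2 zs i j).
have Gam_cvg i j : Gam c (z k) (B k) i j @[k --> \oo] --> kkt_matrix f c zs i j.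
  case: (split_ordP i) => i' Ei; case: (split_ordP j) => j' Ej; last 3 first.
  - apply: cvg_seq_ext (kkt_cvg i j) => k.
    by rewrite Ei Ej /Gam /kkt_matrix !block_mxEur.
  - apply: cvg_seq_ext (kkt_cvg i j) => k.
    by rewrite Ei Ej /Gam /kkt_matrix !block_mxEdl.
  - apply: cvg_seq_ext (kkt_cvg i j) => k.
    by rewrite Ei Ej /Gam /kkt_matrix !block_mxEdr.
  have -> : kkt_matrix f c zs i j = Hs j' i'.
    by rewrite Ei Ej kkt_matrix_ul col_mxKu col_mxKd.
  apply: cvg_seq_ext (@B_cvg j' i') => k.
  have [_ /(_ k)[symB _ _ _]] := run.
  by rewrite Ei Ej /Gam block_mxEul -[in LHS]symB mxE.
have : \forall k \near \oo, forall i j,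
    `|(Gam c (z k) (B k) - kkt_matrix f c zs) i j| <= e / (N * N).+1%:R.
  apply: (filter_forall (F := \oo)) => i.
  apply: (filter_forall (F := \oo)) => j.
  have /cvgrPdist_le/(_ _ k0) := @Gam_cvg i j.
  by apply: filterS => k; rewrite distrC !mxE.
apply: filterS => k hk v; apply: norm2_mulmx_small => //; exact: ltW.
Qed.

(** All linearization errors along the iterates are eventually below any fixed
    eps, and Psi is bounded, so one eps small enough makes both step lemmas
    apply at every late iterate with kappa = theta deltaK. *)
Lemma local_linear_rate :
  let deltaK := delta (par K) in
  theta * deltaK < 1 /\
  forall phi : R, 0 < phi -> \forall k \near \oo,
    alpha k = 1 /\
    norm2 (z k.+1 - zs) <= (1 + phi) * theta * deltaK * norm2 (z k - zs).
Proof.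
have [th0 th1] := theta_bounds.
have [[e10 e20 d0 d1] _] := par_invariant K.
move=> deltaK; pose kappa := theta * deltaK.
have kappa0 : 0 < kappa by rewrite mulr_gt0.
have kappa1 : kappa < 1.
  by apply: le_lt_trans d1; rewrite ler_piMl // ltW.
split=> // phi phi0.
pose s := eta1 (par K) + eta2 (par K).
have s0 : 0 < s by rewrite addr_gt0.
pose omega := (2^-1 - beta inp) * eta2 (par K).
have omega0 : 0 < omega by rewrite mulr_gt0 ?subr_gt0.
pose Psibar := 20 * Num.max UpsB 1 ^+ 2 / (Num.min (xiB inp) 1 * Num.min xiG 1).
have Psi_bar k : Psi_k k <= Psibar.
  exact (Psi_le m_gt0 xiB_gt0 xiG_gt0 (@G_gram k) (B_bounded k)).
have Psibar20 : 20 <= Psibar := le_trans (Psi_k_ge20 0%N) (Psi_bar 0%N).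
have Psibar0 : 0 < Psibar by lra.
pose w := 56 * (1 + s) * Psibar ^+ 2.
have w0 : 0 < w.
  apply: mulr_gt0; last exact: exprn_gt0.
  by apply: mulr_gt0 => //; rewrite addr_gt0.
(* The bound phi kappa / (4 Psibar) yields the factor 1 + phi in the rate; the
   two other bounds are the smallness conditions of the unit step. *)
pose eps := Num.min (Num.min (phi * kappa) 1 / (4 * Psibar)) (omega / w).
have eps0 : 0 < eps.
  rewrite lt_min [X in _ && X]divr_gt0 // andbT.
  by apply: divr_gt0; [rewrite lt_min ltr01 mulr_gt0|rewrite mulr_gt0].
have eps_min : eps * (4 * Psibar) <= Num.min (phi * kappa) 1.
  by rewrite -ler_pdivlMr; [rewrite /eps ge_min lexx|rewrite mulr_gt0].
have eps_w : w * eps <= omega.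
  by rewrite mulrC -ler_pdivlMr // /eps ge_min lexx orbT.
have [epsk eps1] : eps * (4 * Psibar) <= phi * kappa /\ eps * (4 * Psibar) <= 1.
  by move: eps_min; rewrite le_min => /andP.
pose e : 'rV[R]_(n + m) :=
  row_mx (const_mx (eta2 (par K))) (const_mx (eta1 (par K))).
have Phi_grad := joint_lagrangian_has_grad f2 c2.
have gam_grad := gradL_has_grad f2 c2.
have J_cvg := @kkt_matrix_cvg _ _ _ _ _ f2 c2 zs.
have [r r0 incr] := penalized_increment e Phi_grad gam_grad J_cvg gradL_solution
  eps0.
have along (Q : 'cV[R]_(n + m) -> Prop) :
    (\forall y \near zs, Q y) -> \forall k \near \oo, Q (z k).
  by move=> hQ; exact: (z_cvg hQ).
have r4 : 0 < r / 4 by rewrite divr_gt0.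
have near_r := along _ (near_norm2_lt zs r4).
have near_g := along _ (gam_expansion gam_grad gradL_solution eps0).
have near_gA :=
  along _ (penalized_grad_expansion e gam_grad J_cvg gradL_solution eps0).
have near_Gm := Gam_near eps0.
near=> k.
have kK : (K <= k)%N by near: k; exact: nbhs_infty_ge.
have [_ /(_ k)[_ search line step]] := run.
have {}par_k := par_stable kK.
have [_ d_trial] := par_invariant k.
rewrite par_k in search line d_trial.
have acc : accurate f c inp theta (z k) (B k) (par K) (dz k).
  by case: search => N [_ _]; rewrite theta_const.
have desc : descent f c (z k) (par K) (dz k) by case: search => N [].
have hr : norm2 (z k - zs) < r / 4 by near: k; exact: near_r.
have g_model : norm2 (gradL f c (z k) - kkt_matrix f c zs *m (z k - zs)) <=
    eps * norm2 (z k - zs).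
  by near: k; exact: near_g.
have gA_model : norm2 (grad (auglag f c (eta1 (par K)) (eta2 (par K))) (z k) -
    penalized_hess (kkt_matrix f c) e zs *m (z k - zs)) <=
    eps * norm2 (z k - zs).
  rewrite auglag_penalized.
  rewrite (has_gradE (penalized_has_grad e Phi_grad gam_grad _)).
  by near: k; exact: near_gA.
have Gm_model v :
    norm2 ((Gam c (z k) (B k) - kkt_matrix f c zs) *m v) <= eps * norm2 v.
  by move: v; near: k; exact: near_Gm.
set h := z k - zs in hr g_model gA_model *.
set d := dz k in acc desc step line *.
have psi20 := Psi_k_ge20 k; have psi0 : 0 < Psi_k k by lra.
have psi_bar := Psi_bar k.
have Gm_lower :=
  Psi_lower_bound m_gt0 xiB_gt0 xiG_gt0 (@G_gram k) (@B_coercive k).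
have Gm_cond :=
  Psi_opnorm_ge1 m_gt0 xiB_gt0 xiG_gt0 (@G_gram k) (@B_coercive k).
have eps_psi : 4 * Psi_k k * eps <= eps * (4 * Psibar).
  by rewrite mulrC ler_wpM2l ?(ltW eps0) // ler_wpM2l.
have contr := inexact_newton_contraction psi0 Gm_lower Gm_cond (ltW eps0)
  g_model Gm_model (ltW kappa0) (ltW kappa1) acc.
have n0 := norm2_ge0 h.
have hd_le : norm2 (h + d) <= (1 + phi) * theta * deltaK * norm2 h.
  apply: le_trans contr _; rewrite ler_wpM2r //.
  by rewrite /kappa in epsk *; lra.
have alpha1 : alpha k = 1.
  case: line => -[|i] [-> _ fail]; first by rewrite expr0.
  have /negP[] := fail 0%N isT; rewrite expr0 /armijo.
  (* The whole segment from z k to z k + d lies where the model is accurate: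
     |d| <= 3 |h|. *)
  have dh : norm2 d <= norm2 (h + d) + norm2 h.
    by rewrite -{1}(addKr h d) addrC norm2B.
  have small : norm2 h + norm2 d < r.
    have : (kappa + 4 * Psi_k k * eps) * norm2 h <= 2 * norm2 h.
      by rewrite ler_wpM2r //; lra.
    by lra.
  have E_le u : norm2 (diag_mx e *m u) <= s * norm2 u.
    apply: norm2_diag_mx => [|a]; first exact: ltW.
    rewrite /e mxE; case: split_ordP => a' _; rewrite mxE.
      by rewrite ger0_norm ?(ltW e20) // lerDr ltW.
    by rewrite ger0_norm ?(ltW e10) // lerDl ltW.
  have kappa_le : kappa <= omega / ((1 + s) * Psi_k k ^+ 2).
    apply: (@le_trans _ _ deltaK); first by rewrite ler_piMl // ltW.
    by apply: le_trans d_trial _; exact: delta_trial_le.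
  have eps_omega : 56 * (1 + s) * Psi_k k ^+ 2 * eps <= omega.
    have s1 : 0 <= 56 * (1 + s) by lra.
    have psi2 : Psi_k k ^+ 2 <= Psibar ^+ 2.
      by rewrite lerXn2r ?nnegrE ?(ltW psi0) ?(ltW Psibar0).
    apply: (le_trans _ eps_w); rewrite (ler_wpM2r (ltW eps0)) //.
    exact: (ler_wpM2l s1 psi2).
  have decrease := unit_step_sufficient_decrease psi0 Gm_lower Gm_cond
    (ltW eps0) g_model Gm_model (ltW kappa0) (ltW kappa1) acc (ltW s0) E_le
    gA_model desc beta_lt erefl
    psi20 kappa_le omega0 (le_trans eps_psi eps1) eps_omega.
  rewrite scale1r mul1r -lerBlDl auglag_penalized in decrease *.
  exact: le_trans (incr _ _ small) decrease.
split=> //; rewrite step alpha1 scale1r.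
by have -> : z k + d - zs = h + d by rewrite addrAC.
Unshelve. all: by end_near. Qed.

End LocalConvergence.

(** * The almost sure statement *)

Theorem theorem4p3 (R : realType) (n m : nat) (hm : (0 < m)%N)
    (f : 'cV[R]_n -> R) (c : 'cV[R]_n -> 'cV[R]_m)
    (hf2 : Ck_on 2 setT f)
    (hc2 : forall i : 'I_m, Ck_on 2 setT (fun x => c x i 0))
    (inp : adasketch_input R n m) (hinp : valid_input inp)
    (theta : R) (htheta : theta_seq inp = fun=> theta)
    (disp : measure_display) (Omega : measurableType disp)
    (P : probability Omega R)
    (S : nat -> nat -> {RV P >-> sketch_space R (n + m)})
    (B : Omega -> nat -> 'M[R]_n)
    (z : Omega -> nat -> 'cV[R]_(n + m)) (par : Omega -> nat -> tuning R)
    (dz : Omega -> nat -> 'cV[R]_(n + m)) (alpha : Omega -> nat -> R)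
    (hrun : {ae P, forall w, adasketch_run f c inp (B w)
        (fun k j => S k j w) (z w) (par w) (dz w) (alpha w)})
    (xs : 'cV[R]_n) (lams : 'cV[R]_m)
    (hsol : local_solution f c xs) (hmult : lagrange_multiplier f c xs lams)
    (X : set 'cV[R]_n) (Lam : set 'cV[R]_m)
    (hXconv : convex_set X) (hXcomp : compact X)
    (hLconv : convex_set Lam) (hLcomp : compact Lam)
    (hin : {ae P, forall w, forall k : nat,
        X (usubmx (z w k)) /\ Lam (dsubmx (z w k))})
    (hfLip : lipschitz_hess_on X f)
    (hcLip : forall i : 'I_m, lipschitz_hess_on X (fun x => c x i 0))
    (xiG UpsB : R) (hxiG : 0 < xiG) (hUpsB : 0 < UpsB)
    (hG : {ae P, forall w, forall k : nat,
        let G := jac c (usubmx (z w k)) in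
        row_free G /\ loewner_le xiG%:M (G *m G^T)})
    (hB : {ae P, forall w, forall k : nat,
        (forall u : 'cV[R]_n, jac c (usubmx (z w k)) *m u = 0 ->
           xiB inp * norm2 u ^+ 2 <= dot u (B w k *m u)) /\
        opnorm (B w k) <= UpsB})
    (dist : probability (sketch_space R (n + m)) R)
    (hdist : forall (k j : nat) (A : set (sketch_space R (n + m))),
        measurable A -> distribution P (S k j) A = dist A)
    (hindep : mutually_independent (fun kj : nat * nat => S kj.1 kj.2))
    (pi0 : R) (hpi : 0 < pi0 /\ pi0 <= 1)
    (hsketch : forall u : 'cV[R]_(n + m), u != 0 ->
        (pi0%:E <= dist [set s : sketch R (n + m) | (projT2 s)^T *m u != 0%R])%E)
    (hf3 : Ck_on 3 X f) (hc3 : forall i : 'I_m, Ck_on 3 X (fun x => c x i 0))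
    (tau : Omega -> nat -> R)
    (htau : {ae P, forall w, tau w @ \oo --> (0 : R)})
    (hHB : {ae P, forall w,
        (fun k : nat => opnorm
           (hess_xL f c (usubmx (z w k)) (dsubmx (z w k)) - B w k) : R^o)
        =O_\oo (tau w : nat -> R^o)})
    (hz : {ae P, forall w, z w @ \oo --> col_mx xs lams})
    (K : Omega -> nat)
    (hK : {ae P, forall w, forall k : nat, (K w <= k)%N ->
        par w k = par w (K w)}) :
  {ae P, forall w,
    let deltaK := delta (par w (K w)) in
    theta * deltaK < 1 /\
    forall phi : R, 0 < phi ->
      \forall k \near \oo,
        alpha w k = 1 /\
        norm2 (z w k.+1 - col_mx xs lams) <=
          (1 + phi) * theta * deltaK * norm2 (z w k - col_mx xs lams)}.
Proof.
have c_xs : c xs = 0 by case: hsol.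
apply: filterS (filterI hrun (filterI hG (filterI hB (filterI htau (filterI hHB
  (filterI hz hK)))))) => w [run [gram [coer [tau0 [HB [zcvg stable]]]]]].
apply: (local_linear_rate hm hf2 hc2 hinp htheta run c_xs hmult hxiG
  (fun k => (gram k).2) (fun k => (coer k).1) (fun k => (coer k).2) _ zcvg
  stable).
have [C C0 hC] := (eqO_exP _ _ _).1 HB.
apply/cvgr0Pnorm_le => e e0; have eC0 : 0 < e / C by rewrite divr_gt0.
move/cvgr0Pnorm_le : tau0 => /(_ _ eC0) htau0.
near=> k; have hCk :
    `|opnorm (hess_xL f c (usubmx (z w k)) (dsubmx (z w k)) - B w k)|
    <= C * `|tau w k| by near: k; exact: hC.
apply: le_trans hCk _; rewrite mulrC -ler_pdivlMr //; near: k; exact: htau0.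
Unshelve. all: by end_near. Qed.
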